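(* Let $n\geq 2$, let $A\in\mathbb{Z}^{m\times n}$ be an integral matrix of full column rank, and let $b\in\mathbb{Z}^m$ be such that the polyhedron $P=\{x\in\mathbb{R}^n: Ax\le b\}$ is full-dimensional, contains no integer point ($P\cap\mathbb{Z}^n=\emptyset$), and each row of $A$ defines a facet of $P$. Then there exists a row $a^\top$ of $A$ such that \[ w^{a}(P)<\frac{4n+2}{9}\cdot\Delta_n(A)-1. \]
   Context: $\Delta_n(A)$ denotes the maximum of $|\det M|$ over all $n\times n$ submatrices $M$ of $A$. For $a\in\mathbb{R}^n\setminus\{0\}$, the width of $P$ in direction $a$ is $w^{a}(P)=\max_{x\in P}a^\top x-\min_{y\in P}a^\top y$. *)

(* Defs.v *)
From HB Require Import structures.
From mathcomp Require Import all_boot all_order all_algebra.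
From mathcomp Require Import classical_sets reals constructive_ereal ereal.
Set Implicit Arguments. Unset Strict Implicit. Unset Printing Implicit Defensive.
Import Order.TTheory GRing.Theory Num.Theory.
Local Open Scope ring_scope.
Local Open Scope classical_set_scope.

Section Defs.
Variable R : realType.

Definition int2R (m n : nat) (A : 'M[int]_(m, n)) : 'M[R]_(m, n) :=
  map_mx (fun z : int => z%:~R) A.

Definition polyhedron (m n : nat) (A : 'M[int]_(m, n)) (b : 'cV[int]_m) :
  set 'cV[R]_n :=
  [set x | forall i : 'I_m, (int2R A *m x) i 0 <= (b i 0)%:~R].

Definition full_dimensional (n : nat) (P : set 'cV[R]_n) : Prop :=
  exists x : 'cV[R]_n, exists2 e : R, 0 < e &
    forall y : 'cV[R]_n, (forall j, `|y j 0 - x j 0| < e) -> P y.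

Definition lattice_free (n : nat) (P : set 'cV[R]_n) : Prop :=
  forall z : 'cV[int]_n, ~ P (map_mx (fun t : int => t%:~R) z).

Definition aff_indep (n k : nat) (p : 'I_k.+1 -> 'cV[R]_n) : bool :=
  row_free (\matrix_(j < k, l < n) (p (lift ord0 j) l 0 - p ord0 l 0)).

Definition aff_dim_eq (n : nat) (S : set 'cV[R]_n) (d : nat) : Prop :=
  (exists p : 'I_d.+1 -> 'cV[R]_n, (forall j, S (p j)) /\ aff_indep p) /\
  ~ (exists p : 'I_d.+2 -> 'cV[R]_n, (forall j, S (p j)) /\ aff_indep p).

Definition row_defines_facet (m n : nat) (A : 'M[int]_(m, n)) (b : 'cV[int]_m)
  (i : 'I_m) : Prop :=
  aff_dim_eq (polyhedron A b `&` [set x | (int2R A *m x) i 0 = (b i 0)%:~R])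
    n.-1.

Definition width (n : nat) (a : 'rV[R]_n) (P : set 'cV[R]_n) : \bar R :=
  (ereal_sup [set ((a *m x) 0 0)%:E | x in P] -
   ereal_inf [set ((a *m x) 0 0)%:E | x in P])%E.

End Defs.

Definition Delta (m n : nat) (A : 'M[int]_(m, n)) : int :=
  \big[Order.max/0]_(f : {ffun 'I_n -> 'I_m} | injectiveb f)
     `|\det (rowsub f A)|.

(* Main.v *)
Require Import Defs.
From HB Require Import structures.
From mathcomp Require Import all_boot all_order all_algebra.
From mathcomp Require Import classical_sets reals constructive_ereal ereal.
From mathcomp Require Import boolp ring lra zify.
Import Order.TTheory GRing.Theory Num.Theory.
Local Open Scope ring_scope.
Set Implicit Arguments. Unset Strict Implicit. Unset Printing Implicit Defensive.

(** Drop rows of [A] until the remaining system, of index set [S], is minimal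
    without integer points. Pick [i] in [S], put [alpha := row i A], and let [z]
    be an integer point of the system [S \ i] with [alpha z] minimal, so that
    [alpha z >= b_i + 1]. It suffices to show [alpha (z - x) < (4n+2)/9 Delta] for
    every [x] in [P], the minimum of [alpha] over [P] being attained at a vertex.

    Put [y := z - x] and let [C] be the cone cut out by the rows of [A], with signs
    chosen so that [y] lies in [C]. Suppose that [y'] and [y - y'] lie in [C]. If
    [u] is a nonzero integer vector with [u = tau y' + e], [|tau| <= 1], [alpha e = 0]
    and [|a_k e| < 1] for all rows [a_k], then by integrality [z - u] or [z + u]
    satisfies the system [S \ i] and has a smaller value of [alpha], which is
    impossible. By pigeonhole such a [u] exists when [alpha y'] is too large: if [y']
    lies in a face of [C] of dimension 2 (resp. 3), then [alpha y' < Delta] (resp.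
    [alpha y' < 4/3 Delta]). The constant 4/3 is 4 divided by 3, where 3 bounds from
    below the area of a symmetric convex body [L] in the plane that contains the
    polar of [L] rotated by 90 degrees.

    Following edges of [{u | u, y - u in C}] from [0] to [y] one passes a vertex that
    splits [y] into parts in faces of dimensions [k] and [n - k]. Splitting off
    pieces of dimension 3, and at most two of dimension 2, gives the bound
    [(4n+2)/9 Delta]. *)

(** * Pigeonhole modulo a sublattice *)

(** The image of [E] has index [|det E|] in the integer lattice. The Smith normal form turns the
    quotient into a product of cyclic groups, so [key] and the class of [w] together take at most
    [#|K| * |det E|] values. *)
Lemma lattice_pigeonhole n (E : 'M[int]_n) (T K : finType) (key : T -> K)
    (w : T -> 'cV[int]_n) :
  \det E != 0 -> (#|K| * absz (\det E) < #|T|)%N ->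
  exists i j, [/\ i != j, key i = key j & exists u, E *m u = w i - w j].
Proof.
move=> E0 cT.
have [L Lu [Rm Ru [d _ defE]]] := int_Smith_normal_form E.
pose Dg : 'M[int]_n := \matrix_(i, j) (d`_i *+ (i == j :> nat)).
have defDg : Dg = diag_mx (\row_i d`_i).
  by apply/matrixP => i j; rewrite !mxE; case: (i =P j) => [->|/val_eqP/negbTE->];
     rewrite ?eqxx.
have detD : \det Dg = \prod_(i < n) d`_i.
  by rewrite defDg det_diag; apply: eq_bigr => i _; rewrite mxE.
pose e (i : 'I_n) := absz d`_i.
have abs1 (x : int) : x \is a GRing.unit -> absz x = 1%N.
  by rewrite unitrE => /eqP /(congr1 absz); rewrite abszM => /eqP; rewrite muln_eq1 => /andP[/eqP].
have detE : absz (\det E) = (\prod_(i < n) e i)%N.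
  rewrite defE -/Dg !det_mulmx detD !abszM.
  move: Lu Ru; rewrite !unitmxE => Lu Ru.
  rewrite (abs1 _ Lu) (abs1 _ Ru) mul1n muln1.
  by rewrite (big_morph absz abszM absz1).
have d0 (i : 'I_n) : d`_i != 0.
  apply/eqP => di; move/eqP: E0; apply; apply/eqP.
  by rewrite -absz_eq0 detE (bigD1 i) //= /e di.
have e0 (i : 'I_n) : (0 < e i)%N by rewrite absz_gt0.
pose T_ (i : 'I_n) := 'I_((e i).-1.+1).
pose cd (v : 'cV[int]_n) (i : 'I_n) : int := (invmx L *m v) i 0.
pose res (v : 'cV[int]_n) : fprod T_ :=
  [fprod i : 'I_n => (inord (absz (cd v i %% d`_i)%Z) : T_ i)].
pose h (i : T) := (key i, res (w i)).
have cF : #|fprod T_| = absz (\det E).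
  rewrite card_fprod detE; apply: eq_bigr => i _.
  by rewrite card_ord prednK.
have /injectivePn [i [j nij hij]] : ~~ injectiveb h.
  apply/negP => /injectiveP /leq_card; rewrite card_prod cF => le.
  by rewrite ltnNge le in cT.
exists i, j; split=> //; first by have := congr1 fst hij.
have ltm (x : int) k : (absz (x %% d`_(k : 'I_n))%Z < (e k).-1.+1)%N.
  rewrite prednK // -ltz_nat gez0_abs ?modz_ge0 //.
  by rewrite /e abszE ltz_mod.
have modE k : (cd (w i) k %% d`_k)%Z = (cd (w j) k %% d`_k)%Z.
  have /(congr1 (fun f : fprod T_ => f k)) : res (w i) = res (w j) by have := congr1 snd hij.
  rewrite !fprodE => /(congr1 val) /=; rewrite !inordK ?ltm //.
  by move=> /(congr1 Posz); rewrite !gez0_abs ?modz_ge0.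
pose q : 'cV[int]_n := \col_k ((cd (w i - w j)%R k %/ d`_k)%Z).
have Dq : Dg *m q = invmx L *m (w i - w j).
  apply/colP => k; rewrite defDg mul_diag_mx [LHS]mxE [X in X * _]mxE [q k 0]mxE.
  rewrite mulrC divzK //.
  by move: (modE k) => /eqP; rewrite eqz_mod_dvd /cd mulmxBr !mxE.
exists (invmx Rm *m q).
by rewrite {1}defE -/Dg -mulmxA mulKVmx // -mulmxA Dq mulKVmx.
Qed.

(** * Planar bodies *)

Section GridSums.
Variable R : realType.
Implicit Types (x a b : R) (f : R -> R) (N : nat).

(** On each cell a decreasing affine function is at most its value at the left end, so its left
    Riemann sum is at least its integral, here the area of a trapezoid. The error term covers what
    is lost near [a]: the part of the trapezoid before [x0] and the cell that [a] splits. *)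
Lemma sum_affine_minorant f N x0 a b (A B : R) :
  (0 < N)%N -> 0 <= x0 <= N%:R^-1 -> 0 <= a -> a <= b -> b <= 1 ->
  0 <= B -> B <= A ->
  (forall x, a <= x < b -> A * (b - x) + B * (x - a) <= f x * (b - a)) ->
  N%:R * ((b - a) * (A + B) / 2) - 2 * A <=
  \sum_(i < N) (if a <= x0 + i%:R / N%:R < b then f (x0 + i%:R / N%:R) else 0).
Proof.
move=> N0 /andP[x00 x0N] a0 ab b1 B0 BA fab.
have nN : 0 < N%:R :> R by rewrite ltr0n.
set d := N%:R^-1; have d0 : 0 < d by rewrite invr_gt0.
have Nd : N%:R * d = 1 by rewrite mulfV // gt_eqF.
have [eab|nab] := eqVneq a b.
  rewrite eab big1 => [|i _]; first by nra.
  by case: ifP => // /andP[p q]; lra.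
have {ab nab} ab : a < b by rewrite lt_neqAle nab.
pose c : R := (A - B) / (b - a).
have c0 : 0 <= c by rewrite divr_ge0 // subr_ge0 // ltW.
have cE : c * (b - a) = A - B by rewrite divfK // subr_eq0 gt_eqF.
pose z x := Num.min x b - a.
(* [W x] is the integral of the affine minorant from [a] to [Num.min x b], and zero before [a]. *)
pose W x : R := if x < a then 0 else A * z x - c * z x ^+ 2 / 2.
pose y M := x0 + M%:R * d.
pose g x := if a <= x < b then f x else 0.
(* The indicators form a potential that pays [A] once, in the cell where [x < a <= x + d]: there
   [g x] vanishes while [W] may grow by [A * d]. *)
have step x : N%:R * (W (x + d) - W x) + A * (x + d < a)%R%:R <= g x + A * (x < a)%R%:R.
  rewrite /W /g /z; case: (ltP x a) => xa.
    case: (ltP (x + d) a) => xda; first by rewrite /= subr0 mulr0 mulr1; lra.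
    rewrite /= subr0 mulr0 mulr1 addr0 add0r.
    set w := _ - a.
    have w0 : 0 <= w by rewrite subr_ge0 le_min xda ltW.
    have wd : w <= d.
      have : Num.min (x + d) b <= x + d by rewrite ge_min lexx.
      by rewrite /w; lra.
    have : A * w - c * w ^+ 2 / 2 <= A * d.
      by have := mulr_ge0 c0 (sqr_ge0 w); nra.
    by move/(ler_wpM2l (ltW nN)); rewrite [X in _ <= X]mulrCA Nd mulr1.
  have -> : (x + d < a) = false by apply/negbTE; rewrite -leNgt; lra.
  rewrite !mulr0 !addr0 /=.
  case: (ltP x b) => xb; last first.
    rewrite (min_idPr _); last by lra.
    by rewrite subrr mulr0.
  set w := Num.min _ _.
  have xw : x <= w by rewrite le_min (ltW xb) andbT; lra.
  have wd : w <= x + d by rewrite ge_min lexx.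
  have := fab x; rewrite xa xb => /(_ isT) fx.
  have cz : A - c * (x - a) <= f x.
    rewrite -(ler_pM2r (_ : 0 < b - a)) ?subr_gt0 //; apply: le_trans fx.
    by rewrite mulrBl -mulrA [(x - a) * _]mulrC mulrA cE; lra.
  have cz0 : 0 <= A - c * (x - a).
    have : c * (x - a) <= c * (b - a) by apply: ler_wpM2l => //; lra.
    by rewrite cE; lra.
  have -> : A * (w - a) - c * (w - a) ^+ 2 / 2 - (A * (x - a) - c * (x - a) ^+ 2 / 2)
     = (w - x) * (A - c * (x - a)) - c * (w - x) ^+ 2 / 2 by field.
  have : (w - x) * (A - c * (x - a)) - c * (w - x) ^+ 2 / 2 <= d * (A - c * (x - a)).
    have := mulr_ge0 c0 (sqr_ge0 (w - x)).
    have : (w - x) * (A - c * (x - a)) <= d * (A - c * (x - a)).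
      by apply: ler_wpM2r => //; lra.
    lra.
  move/(ler_wpM2l (ltW nN)); rewrite [X in _ <= X]mulrA Nd mul1r; lra.
have tele M : N%:R * (W (y M) - W (y 0%N)) + A * (y M < a)%R%:R <=
     \sum_(i < M) g (y i) + A * (y 0%N < a)%R%:R.
  elim: M => [|M IH]; first by rewrite subrr mulr0 big_ord0.
  rewrite big_ord_recr /=.
  have yS : y M.+1 = y M + d by rewrite /y -natr1; ring.
  have := step (y M); rewrite -yS; lra.
have yN : y N = x0 + 1 by rewrite /y Nd.
have := tele N.
have -> : (y N < a) = false by apply/negbTE; rewrite -leNgt yN; lra.
have -> : W (y N) = (b - a) * (A + B) / 2.
  rewrite /W /z yN ltNge; have -> /= : a <= x0 + 1 by lra.
  rewrite (min_idPr _); last by lra.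
  have -> : c * (b - a) ^+ 2 / 2 = (A - B) * (b - a) / 2.
    by rewrite -cE; field.
  by field.
have W0 : N%:R * W (y 0%N) <= A.
  rewrite /W /y mul0r addr0; case: ltP => xa; first by rewrite mulr0; lra.
  have z0 : 0 <= z x0 by rewrite subr_ge0 le_min xa ltW.
  have zd : z x0 <= d.
    have : Num.min x0 b <= x0 by rewrite ge_min lexx.
    by rewrite /z; move: x0N; rewrite -/d; lra.
  have : A * z x0 - c * z x0 ^+ 2 / 2 <= A * d.
    by have := mulr_ge0 c0 (sqr_ge0 (z x0)); nra.
  by move/(ler_wpM2l (ltW nN)); rewrite [X in _ <= X]mulrCA Nd mulr1.
have : A * (y 0%N < a)%R%:R <= A by case: (_ < _); rewrite ?mulr0 ?mulr1 //; lra.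
rewrite mulrBr mulr0 addr0.
rewrite [X in _ -> _ -> _ <= X](_ : _ = \sum_(i < N) g (y i)); last by [].
by lra.
Qed.

Lemma count_open_interval M (A B : R) : -1 <= A -> B <= M%:R ->
  B - A - 1 <= \sum_(j < M) (A < j%:R < B)%R%:R.
Proof.
move=> A1; elim: M B => [|M IH] B BM; first by rewrite big_ord0; lra.
rewrite big_ord_recr /=.
have sge0 (C : R) : 0 <= \sum_(j < M) (A < j%:R < C)%R%:R :> R.
  by apply: sumr_ge0.
rewrite -natr1 in BM.
have [BM'|BM'] := leP B M%:R.
  have := IH B BM'; set S := \sum_(_ < M) _; rewrite andbF addr0; lra.
have [AM|AM] := ltP A M%:R; last first.
  by rewrite /= addr0; have := sge0 B; lra.
have := IH M%:R (lexx _).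
pose F (C : R) (j : 'I_M) : R := (A < j%:R < C)%R%:R.
have : \sum_(j < M) F M%:R j <= \sum_(j < M) F B j.
  apply: ler_sum => j _; rewrite ler_nat /=.
  by case: (A < j%:R) => //=; case: ltP => // jM; rewrite (lt_trans jM BM').
by rewrite /F /=; lra.
Qed.
End GridSums.

(* The hypothesis on [l2] makes the area under the polygonal line through
   [(0, 1)], [(l1, l2)], [(y, f y)] and [(1, 0)] equal to [(1 + f y) / 2]. *)
Lemma sum_concave_minorant (R : realType) (f : R -> R) N x0 y l1 l2 :
  (0 < N)%N -> 0 <= x0 <= N%:R^-1 ->
  (forall a b x, a <= x -> x <= b ->
     f a * (b - x) + f b * (x - a) <= f x * (b - a)) ->
  f 0 = 1 -> (forall x, 0 <= x <= 1 -> 0 <= f x) -> (forall x, f x <= 1) ->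
  0 < y <= 1 -> 0 <= l1 <= 1 -> l2 <= 1 -> l2 <= f l1 ->
  l2 * y = 1 - l1 * (1 - f y) ->
  N%:R * ((1 + f y) / 2) - 6 <= \sum_(i < N) f (x0 + i%:R / N%:R).
Proof.
move=> N0 x0b fconc f0 fge0 fle1 /andP[y0 y1] /andP[l10 l11] l21 l2f e.
have nN : 0 < N%:R :> R by rewrite ltr0n.
have fy0 : 0 <= f y by apply: fge0; lra.
have fy1 := fle1 y.
(* If [y < l1], concavity on [[0, l1]] and the equation for [l2] would force [1 <= y]. *)
have l1y : l1 <= y.
  rewrite leNgt; apply/negP => yl; have := fconc 0 l1 y (ltW y0) (ltW yl).
  have := ler_wpM2r (ltW y0) l2f; rewrite f0 e; nra.
have fl2 : f y <= l2.
  rewrite -(ler_pM2r y0) e; have : l1 * (1 - f y) <= 1 - f y by rewrite ler_piMl //; lra.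
  have : f y * y <= f y by rewrite ler_piMr.
  lra.
have l20 : 0 <= l2 by lra.
(* The trapezoids over [[0, l1]], [[l1, y]] and [[y, 1]] lose [2], [2 * l2] and [2 * f y], at most 6
   in all. *)
have S1 : N%:R * ((l1 - 0) * (1 + l2) / 2) - 2 * 1 <=
  \sum_(i < N) (if 0 <= x0 + i%:R / N%:R < l1 then f (x0 + i%:R / N%:R) else 0).
  apply: sum_affine_minorant => // x /andP[xa xb].
  apply: le_trans (fconc 0 l1 x xa (ltW xb)); rewrite f0 lerD2l.
  by apply: ler_wpM2r => //; lra.
have S2 : N%:R * ((y - l1) * (l2 + f y) / 2) - 2 * l2 <=
  \sum_(i < N) (if l1 <= x0 + i%:R / N%:R < y then f (x0 + i%:R / N%:R) else 0).
  apply: sum_affine_minorant => // x /andP[xa xb].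
  apply: le_trans (fconc l1 y x xa (ltW xb)); rewrite lerD2r.
  by apply: ler_wpM2r => //; lra.
have S3 : N%:R * ((1 - y) * (f y + 0) / 2) - 2 * f y <=
  \sum_(i < N) (if y <= x0 + i%:R / N%:R < 1 then f (x0 + i%:R / N%:R) else 0).
  apply: sum_affine_minorant => //; first exact: ltW.
  move=> x /andP[xa xb].
  apply: le_trans (fconc y 1 x xa (ltW xb)); rewrite lerD2l.
  by apply: ler_wpM2r; [lra | apply: fge0; lra].
have -> : N%:R * ((1 + f y) / 2) =
   N%:R * ((l1 - 0) * (1 + l2) / 2) + N%:R * ((y - l1) * (l2 + f y) / 2)
   + N%:R * ((1 - y) * (f y + 0) / 2).
  rewrite -!mulrDr -!mulrDl; congr (_ * (_ / 2)).
  have -> : (l1 - 0) * (1 + l2) + (y - l1) * (l2 + f y) + (1 - y) * (f y + 0)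
    = l1 + l2 * y - l1 * f y + f y by ring.
  rewrite e; ring.
have le3 : \sum_(i < N) (if 0 <= x0 + i%:R / N%:R < l1 then f (x0 + i%:R / N%:R) else 0)
  + \sum_(i < N) (if l1 <= x0 + i%:R / N%:R < y then f (x0 + i%:R / N%:R) else 0)
  + \sum_(i < N) (if y <= x0 + i%:R / N%:R < 1 then f (x0 + i%:R / N%:R) else 0)
  <= \sum_(i < N) f (x0 + i%:R / N%:R).
  rewrite -!big_split /=; apply: ler_sum => i _.
  set x := x0 + _.
  have xb : 0 <= x <= 1.
    case/andP: x0b => x00 x0N; rewrite addr_ge0 ?divr_ge0 //=.
    have : i%:R + 1 <= N%:R :> R by rewrite natr1 ler_nat.
    move/(ler_wpM2r (ltW (_ : 0 < N%:R^-1))); rewrite invr_gt0 => /(_ nN).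
    by rewrite mulfV ?gt_eqF // mulrDl mul1r /x; lra.
  have := fge0 x xb.
  case: ifP => /andP c1; case: ifP => /andP c2; case: ifP => /andP c3; move: c1 c2 c3; lra.
lra.
Qed.

(** * Area of a symmetric planar body cut out by functionals with pairwise determinants at most 1 *)

Section PlanarBody.
Variables (R : realType) (K : finType) (s t : K -> R) (neg : K -> K) (ka kb : K).
Hypothesis s_neg : forall k, s (neg k) = - s k.
Hypothesis t_neg : forall k, t (neg k) = - t k.
Hypothesis s_ka : s ka = 1.
Hypothesis t_ka : t ka = 0.
Hypothesis s_kb : s kb = 0.
Hypothesis t_kb : t kb = 1.
Hypothesis det_le1 : forall k j, s k * t j - t k * s j <= 1.

Let s_le1 k : s k <= 1.
Proof. by have := det_le1 k kb; rewrite t_kb s_kb; lra. Qed.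

Let t_le1 k : t k <= 1.
Proof. by have := det_le1 ka k; rewrite t_ka s_ka; lra. Qed.

Let t_geN1 k : -1 <= t k.
Proof. by have := t_le1 (neg k); rewrite t_neg; lra. Qed.

(* [(right_end y, y)] is the right end of the chord of height [y] of the body
   [{(x, y) | s k * x + t k * y <= 1 for all k}]. *)
Definition right_end (y : R) : R :=
  let k := [arg min_(k < ka | 0 < s k) ((1 - t k * y) / s k)]%O in
  (1 - t k * y) / s k.

Lemma right_end_attained y : exists2 k, 0 < s k & s k * right_end y = 1 - t k * y.
Proof.
rewrite /right_end; case: arg_minP => [|k sk _]; first by rewrite s_ka.
by exists k => //; rewrite mulrC divfK // gt_eqF.
Qed.

Lemma right_end_le y k : 0 < s k -> s k * right_end y <= 1 - t k * y.
Proof.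
move=> sk; rewrite /right_end; case: arg_minP => [|j sj /(_ k sk) le]; first by rewrite s_ka.
by rewrite mulrC -ler_pdivlMr.
Qed.

Lemma right_end_le1 y : right_end y <= 1.
Proof. by have := @right_end_le y ka; rewrite s_ka t_ka mul0r mul1r subr0; exact. Qed.

(** All [s k] and [t k] lie between -1 and 1, so the body contains the square [|x| + |y| <= 1]. *)
Lemma right_end_ge y : -1 <= y <= 1 -> 1 - `|y| <= right_end y.
Proof.
move=> /andP[y1 y2]; have [k sk e] := right_end_attained y.
have := s_le1 k; have := t_le1 k; have := t_geN1 k => t1 t2 s1.
rewrite -(ler_pM2l sk) e.
have : t k * y <= `|y|.
  by apply: le_trans (ler_norm _) _; rewrite normrM ler_piMl // ler_norml t1.
have : 0 <= 1 - `|y| by rewrite subr_ge0 ler_norml y1.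
by nra.
Qed.

Lemma right_end_ge0 y : -1 <= y <= 1 -> 0 <= right_end y.
Proof.
move=> yb; apply: le_trans (right_end_ge yb); rewrite subr_ge0 ler_norml; exact: yb.
Qed.

Lemma right_end0 : right_end 0 = 1.
Proof.
apply/eqP; rewrite eq_le right_end_le1 /=.
by have := @right_end_ge 0; rewrite normr0 subr0; apply; lra.
Qed.

Lemma right_end_concave a b x : a <= x -> x <= b ->
  right_end a * (b - x) + right_end b * (x - a) <= right_end x * (b - a).
Proof.
move=> ax xb; have [k sk e] := right_end_attained x.
rewrite -(ler_pM2l sk).
have := right_end_le a sk; have := right_end_le b sk => pb qa.
have := ler_wpM2r (_ : 0 <= b - x) qa; have := ler_wpM2r (_ : 0 <= x - a) pb.
rewrite !subr_ge0 => /(_ ax) h1 /(_ xb) h2.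
have -> : s k * (right_end x * (b - a)) = (1 - t k * x) * (b - a) by rewrite mulrA e.
by lra.
Qed.

(* The body contains its polar rotated by 90 degrees. *)
Lemma right_end_dual k : 0 < s k -> t k <= right_end (- s k) /\ - t k <= right_end (s k).
Proof.
move=> sk; split.
  have [j sj e] := right_end_attained (- s k).
  by rewrite -(ler_pM2l sj) e; have := det_le1 j k; lra.
have [j sj e] := right_end_attained (s k).
by rewrite -(ler_pM2l sj) e; have := det_le1 k j; lra.
Qed.

(** By central symmetry the left end of the chord of height [y] has abscissa [- right_end (- y)];
    this handles the functionals with [s k < 0]. *)
Lemma mem_planar_body x y k : -1 < y < 1 -> - right_end (- y) < x < right_end y ->
  s k * x + t k * y < 1.
Proof.
move=> /andP[y1 y2] /andP[x1 x2]; have t1 := t_le1 k; have t2 := t_geN1 k.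
have [sk|sk|sk] := ltrgt0P (s k).
- by have := right_end_le y sk; have : s k * x < s k * right_end y; [rewrite ltr_pM2l | lra].
- have := @right_end_le (- y) (neg k); rewrite s_neg t_neg oppr_gt0 => /(_ sk).
  have : s k * x < - s k * right_end (- y) by rewrite mulNr -mulrN ltr_nM2l.
  lra.
- rewrite sk mul0r add0r; apply: le_lt_trans (ler_norm _) _; rewrite normrM.
  have : `|y| < 1 by rewrite ltr_norml y1.
  have : `|t k| <= 1 by rewrite ler_norml t2.
  by have := normr_ge0 y; have := normr_ge0 (t k); nra.
Qed.

(* At the height [y] of a chord of length 1, functionals supporting the body at
   the two ends of the chord yield, by [right_end_dual], further boundary points
   which account for an area of 3. *)
Lemma unit_chord : 1 <= right_end 1 + right_end (-1) \/
  exists2 y, 0 <= y <= 1 & right_end y + right_end (- y) = 1.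
Proof.
have [|lt1] := leP 1 (right_end 1 + right_end (-1)); [by left | right].
(* The length of the chord of height [y] is the minimum of the affine functions [val p], and it is 2
   at height 0. The least height [cross p] at which some [val p] descends to 1 therefore has a chord
   of length exactly 1. *)
pose val (p : K * K) y := (1 - t p.1 * y) / s p.1 + (1 + t p.2 * y) / s p.2.
pose slope (p : K * K) := t p.1 / s p.1 - t p.2 / s p.2.
have valE p y : val p y = val p 0 - slope p * y by rewrite /val /slope; ring.
pose good (p : K * K) := [&& 0 < s p.1, 0 < s p.2 & val p 1 < 1].
have val0 p : 0 < s p.1 -> 0 < s p.2 -> 2 <= val p 0.
  move=> p1 p2; rewrite /val !mulr0 subr0 addr0 !div1r.
  have := s_le1 p.1; have := s_le1 p.2.
  by rewrite -(invf_ge1 p1) -(invf_ge1 p2); lra.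
have attain y : exists p, [/\ 0 < s p.1, 0 < s p.2 & val p y = right_end y + right_end (- y)].
  have [k sk e] := right_end_attained y; have [j sj e'] := right_end_attained (- y).
  exists (k, j); split=> //; rewrite /val /= -e -[1 + _](_ : s j * right_end (- y) = _); last first.
    by rewrite e' mulrN opprK.
  by rewrite mulrC mulKf ?gt_eqF // mulrC mulKf ?gt_eqF.
have val_ge p y : 0 < s p.1 -> 0 < s p.2 -> right_end y + right_end (- y) <= val p y.
  move=> p1 p2; apply: lerD; rewrite ler_pdivlMr // mulrC.
    exact: right_end_le.
  by have := right_end_le (- y) p2; rewrite mulrN opprK.
have [p0 [p01 p02 e0]] := attain 1.
have gp0 : good p0 by rewrite /good p01 p02 e0.
pose cross p := (val p 0 - 1) / slope p.
case: (@arg_minP _ _ _ p0 good cross gp0) => p /and3P[p1 p2 pv] pmin.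
have crossP q : good q -> [/\ 0 < slope q, 0 <= cross q <= 1 & val q (cross q) = 1].
  move=> /and3P[q1 q2 qv]; have v0 := val0 q q1 q2.
  have := valE q 1; rewrite mulr1 => v1.
  have sl : 0 < slope q by lra.
  split=> //.
    apply/andP; split; first by rewrite divr_ge0 ?ltW //; lra.
    by rewrite ler_pdivrMr // mul1r; lra.
  by rewrite valE /cross mulrC divfK ?gt_eqF //; lra.
have [sl cr cv] : [/\ 0 < slope p, 0 <= cross p <= 1 & val p (cross p) = 1].
  by apply: crossP; rewrite /good p1 p2.
exists (cross p) => //; apply/eqP; rewrite eq_le; apply/andP; split.
  by rewrite -cv; apply: val_ge.
have [q [q1 q2 <-]] := attain (cross p).
have v0 := val0 q q1 q2.
(* A pair that is not good is at least 1 on all of [[0, 1]], being affine and at least 2 at 0. *)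
have [qv|qv] := ltP (val q 1) 1; last first.
  rewrite valE; move: qv; rewrite valE mulr1 => qv.
  case/andP: cr => c0 c1; have [|] := leP 0 (slope q) => sq; nra.
have gq : good q by rewrite /good q1 q2.
have [slq crq cvq] := crossP q gq.
rewrite -cvq (valE q (cross q)) (valE q (cross p)) lerD2l lerN2 ler_pM2l //.
exact: pmin.
Qed.

(** The upper half of the body has area at least 3/2. If the chord at height 1 has length at least
    1, a trapezoid with parallel sides 2 and 1 suffices. Otherwise, at a unit chord of height [y],
    the parts with positive and negative abscissa have areas at least [(1 + right_end y) / 2] and
    [(1 + right_end (- y)) / 2], with sum 3/2. *)
Lemma sum_chord_ge N (x0 : R) : (0 < N)%N -> 0 <= x0 <= N%:R^-1 ->
  N%:R * (3 / 2) - 12 <=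
  \sum_(i < N) (right_end (x0 + i%:R / N%:R) + right_end (- (x0 + i%:R / N%:R))).
Proof.
move=> N0 x0b.
have nN : 0 < N%:R :> R by rewrite ltr0n.
have concN a b x : a <= x -> x <= b ->
    right_end (- a) * (b - x) + right_end (- b) * (x - a) <= right_end (- x) * (b - a).
  move=> ax xb; have := @right_end_concave (- b) (- a) (- x); rewrite !lerN2 => /(_ xb ax).
  lra.
have ge0 x : 0 <= x <= 1 -> 0 <= right_end x by move=> ?; apply: right_end_ge0; lra.
have ge0N x : 0 <= x <= 1 -> 0 <= right_end (- x) by move=> ?; apply: right_end_ge0; lra.
case: unit_chord => [ge1|[y /andP[y0 y1] e]].
  have H : N%:R * ((1 - 0) * (2 + 1) / 2) - 2 * 2 <= \sum_(i < N)
     (if 0 <= x0 + i%:R / N%:R < 1 then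
        right_end (x0 + i%:R / N%:R) + right_end (- (x0 + i%:R / N%:R)) else 0).
    apply: (@sum_affine_minorant R (fun x => right_end x + right_end (- x))); rewrite ?ler01 ?ler0n //; try lra.
    move=> x /andP[xa xb].
    have := right_end_concave xa (ltW xb); have := concN 0 1 x xa (ltW xb).
    rewrite oppr0 right_end0.
    have := ler_wpM2r xa ge1; lra.
  apply: le_trans (_ : _ <= N%:R * ((1 - 0) * (2 + 1) / 2) - 2 * 2) _; first by lra.
  apply: le_trans H _; apply: ler_sum => i _.
  case: ifP => // _.
  have xb : 0 <= x0 + i%:R / N%:R <= 1.
    case/andP: x0b => x00 x0N; rewrite addr_ge0 ?divr_ge0 //=.
    have : i%:R + 1 <= N%:R :> R by rewrite natr1 ler_nat.
    move/(ler_wpM2r (ltW (_ : 0 < N%:R^-1))); rewrite invr_gt0 => /(_ nN).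
    by rewrite mulfV ?gt_eqF // mulrDl mul1r; lra.
  by apply: addr_ge0; [apply: ge0 | apply: ge0N].
have {}y0 : 0 < y.
  rewrite lt_neqAle y0 andbT; apply/eqP => y0'; move: e.
  by rewrite -y0' oppr0 right_end0; lra.
(* The functional at one end of the chord gives, by duality, a boundary point on the other side:
   [(s j, - t j)] serves [right_end], and [(s k, t k)] its mirror image. As the chord has length 1,
   [ej] and [ek] are the equations required of [l2]. *)
have [k sk ek] := right_end_attained y; have [k2 _] := right_end_dual sk.
have [j sj ej] := right_end_attained (- y); have [_ j2] := right_end_dual sj.
have k1 := s_le1 k; have j1 := s_le1 j; have tk := t_le1 k; have tj := t_geN1 j.
have A1 : N%:R * ((1 + right_end y) / 2) - 6 <= \sum_(i < N) right_end (x0 + i%:R / N%:R).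
  apply: (@sum_concave_minorant R right_end N x0 y (s j) (- t j)) => //.
  - by move=> *; apply: right_end_concave.
  - exact: right_end0.
  - exact: right_end_le1.
  - by rewrite y0.
  - by rewrite ltW.
  - by lra.
  - have -> : 1 - right_end y = right_end (- y) by lra.
    by rewrite ej; lra.
have A2 : N%:R * ((1 + right_end (- y)) / 2) - 6 <= \sum_(i < N) right_end (- (x0 + i%:R / N%:R)).
  apply: (@sum_concave_minorant R (fun x => right_end (- x)) N x0 y (s k) (t k)) => //.
  - by rewrite oppr0 right_end0.
  - by move=> x; apply: right_end_le1.
  - by rewrite y0.
  - by rewrite ltW.
  - have -> : 1 - right_end (- y) = right_end y by lra.
    by rewrite ek; lra.
rewrite big_split /=.
have : N%:R * ((1 + right_end y) / 2) + N%:R * ((1 + right_end (- y)) / 2) = N%:R * (3 / 2).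
  by rewrite -mulrDr; congr (_ * _); lra.
lra.
Qed.

(** Area 3 yields about [3 * N ^ 2] interior points of a grid of mesh [1 / N]. The error is uniform
    in the offset of the grid, which varies in the application. *)
Lemma planar_count_ge N (x0 w0 : R) : (0 < N)%N ->
  0 <= x0 < N%:R^-1 -> 0 <= w0 < N%:R^-1 ->
  3 * N%:R ^+ 2 - 28 * N%:R <=
  \sum_(i < N + N) \sum_(j < N + N)
    ([forall k, s k * (-1 + w0 + j%:R / N%:R) + t k * (-1 + x0 + i%:R / N%:R) < 1]%R%:R : R).
Proof.
move=> N0 /andP[x00 x0N] /andP[w00 w0N].
have nN : 0 < N%:R :> R by rewrite ltr0n.
have nV : N%:R^-1 * N%:R = 1 :> R by rewrite mulVf // gt_eqF.
pose u (i : nat) : R := -1 + x0 + i%:R / N%:R.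
pose c y := right_end y + right_end (- y).
(* Only the row [i = 0] can have height -1, outside the range of [mem_planar_body]; its whole chord,
   at most [2 * N], is given up. *)
have row (i : 'I_(N + N)) : N%:R * c (u i) - 1 - 2 * N%:R * (i == 0 :> nat)%:R <=
    \sum_(j < N + N) ([forall k, s k * (-1 + w0 + j%:R / N%:R) + t k * u i < 1]%R%:R : R).
  have iN : i%:R / N%:R <= 2 - N%:R^-1 :> R.
    have le : i%:R + 1 <= N%:R + N%:R :> R by rewrite natr1 -natrD ler_nat.
    by rewrite -(ler_pM2r nN) mulrBl -mulrA nV; lra.
  have iN0 : 0 <= i%:R / N%:R :> R by rewrite divr_ge0.
  have ue : -1 <= u i < 1 by rewrite /u; lra.
  have cle : c (u i) <= 2 by have := right_end_le1 (u i); have := right_end_le1 (- u i); rewrite /c; lra.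
  have sge0 : 0 <= \sum_(j < N + N) ([forall k, s k * (-1 + w0 + j%:R / N%:R) + t k * u i < 1]%R%:R : R).
    by apply: sumr_ge0.
  have [u1|u1] := ltP (-1) (u i); last first.
    have i0 : (i == 0 :> nat).
      rewrite -leqn0 leqNgt; apply/negP => i1.
      have : 1 <= i%:R :> R by rewrite ler1n.
      move/(ler_wpM2r (ltW (_ : 0 < N%:R^-1))); rewrite invr_gt0 => /(_ nN).
      have iV : 0 < N%:R^-1 :> R by rewrite invr_gt0.
      by move: u1; rewrite /u; lra.
    by rewrite i0 mulr1; apply: le_trans sge0; have := ler_wpM2l (ltW nN) cle; lra.
  apply: le_trans (_ : N%:R * c (u i) - 1 <= _).
    have : 0 <= 2 * N%:R * (i == 0 :> nat)%:R :> R by rewrite !mulr_ge0.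
    lra.
  pose A := N%:R * (- right_end (- u i) + 1 - w0).
  pose B := N%:R * (right_end (u i) + 1 - w0).
  have A1 : -1 <= A.
    have -> : A = N%:R * (1 - right_end (- u i)) - N%:R * w0 by rewrite /A; ring.
    have := right_end_le1 (- u i) => le1.
    have : 0 <= N%:R * (1 - right_end (- u i)) by rewrite mulr_ge0 //; lra.
    have : N%:R * w0 <= 1 by rewrite mulrC -ler_pdivlMr // mul1r ltW.
    lra.
  have B1 : B <= (N + N)%:R.
    rewrite natrD -[X in X + X]mulr1 -mulrDr ler_pM2l //.
    by have := right_end_le1 (u i); lra.
  have := count_open_interval A1 B1.
  have -> : B - A - 1 = N%:R * c (u i) - 1 by rewrite /A /B /c; ring.
  move/le_trans; apply; apply: ler_sum => j _; rewrite ler_nat.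
  case: (boolP (A < _ < B)) => // /andP[Aj jB]; rewrite (_ : [forall k, _] = true) //.
  apply/forallP => k; apply: mem_planar_body; first by case/andP: ue => _ ->; rewrite u1.
  have {}Aj : - right_end (- u i) + 1 - w0 < j%:R / N%:R by rewrite ltr_pdivlMr // mulrC.
  have {}jB : j%:R / N%:R < right_end (u i) + 1 - w0 by rewrite ltr_pdivrMr // mulrC.
  by apply/andP; split; lra.
have sumc : N%:R * 3 - 24 <= \sum_(i < N + N) c (u i).
  (* The rows below height 0, read downwards, form a grid with offset [N%:R^-1 - x0]. *)
  rewrite big_split_ord /= (reindex_inj rev_ord_inj) /=.
  have := @sum_chord_ge N x0 N0; rewrite x00 ltW // => /(_ isT).
  have := @sum_chord_ge N (N%:R^-1 - x0) N0; rewrite subr_ge0 ltW // lerBlDr lerDl x00 => /(_ isT).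
  have -> : \sum_(i < N) (right_end (N%:R^-1 - x0 + i%:R / N%:R) +
       right_end (- (N%:R^-1 - x0 + i%:R / N%:R))) = \sum_(i < N) c (u (N - i.+1)%N).
    apply: eq_bigr => i _; rewrite /c addrC /u natrB // -natr1.
    have -> : -1 + x0 + (N%:R - (i%:R + 1)) / N%:R = - (N%:R^-1 - x0 + i%:R / N%:R).
      by field; rewrite gt_eqF.
    by rewrite opprK.
  have -> : \sum_(i < N) (right_end (x0 + i%:R / N%:R) + right_end (- (x0 + i%:R / N%:R)))
     = \sum_(i < N) c (u (N + i)%N).
    apply: eq_bigr => i _; rewrite /c /u natrD.
    have -> // : -1 + x0 + (N%:R + i%:R) / N%:R = x0 + i%:R / N%:R.
    by field; rewrite gt_eqF.
  lra.
apply: le_trans (ler_sum _ (fun i _ => row i)).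
rewrite !sumrB -mulr_sumr sumr_const card_ord -mulr_sumr.
have -> : \sum_(i < N + N) (i == 0 :> nat)%:R = 1 :> R.
  have NN0 : (0 < N + N)%N by rewrite addn_gt0 N0.
  rewrite (bigD1 (Ordinal NN0)) //= big1 ?addr0 // => i.
  by rewrite -val_eqE /= => /negbTE ->.
rewrite natrD mulr1.
(* The constant 28 is 24 from [sumc], 2 for the loss of 1 in each of the [2 * N] rows, and 2 for the
   row [i = 0]. *)
have := ler_wpM2l (ltW nN) sumc; nra.
Qed.
End PlanarBody.

(** * Vertices and faces of polyhedra *)

(** Finitely many keys leave finitely many values. With sets of tight rows as keys, this maximizes
    over the vertices of a polyhedron. *)
Lemma exists_max_of_finite_key (R : realType) (X : Type) (F : finType)
    (key : X -> F) (P : X -> Prop) (v : X -> R) :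
  (forall x x', P x -> P x' -> key x = key x' -> v x = v x') ->
  (exists x, P x) -> exists2 x, P x & forall x', P x' -> v x' <= v x.
Proof.
move=> keyP [x0 Px0].
have /choice [g gP] : forall k : F, exists x, (exists2 x', P x' & key x' = k) ->
    P x /\ key x = k.
  move=> k; case: (pselect (exists2 x', P x' & key x' = k)) => [[x Px kx]|nk].
    by exists x.
  by exists x0 => /nk.
pose Q (k : F) := `[< exists2 x', P x' & key x' = k >].
have Q0 : Q (key x0) by apply/asboolP; exists x0.
case: (@arg_maxP _ _ _ (key x0) Q (fun k => v (g k)) Q0) => k /asboolP /gP [Pg _] kmax.
exists (g k) => // x Px.
have ex : exists2 x', P x' & key x' = key x by exists x.
have [Pgx kgx] := gP _ ex.
by rewrite -(keyP _ _ Pgx Px kgx); apply: kmax; apply/asboolP.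
Qed.

Section RowSpans.
Variables (R : realType) (n : nat).
Implicit Types (x y u w : 'cV[R]_n) (c : 'rV[R]_n).

Definition dot (c : 'rV[R]_n) (x : 'cV[R]_n) : R := (c *m x) 0 0.

Lemma dotD c x y : dot c (x + y) = dot c x + dot c y.
Proof. by rewrite /dot mulmxDr mxE. Qed.

Lemma dotN c x : dot c (- x) = - dot c x.
Proof. by rewrite /dot mulmxN mxE. Qed.

Lemma dotB c x y : dot c (x - y) = dot c x - dot c y.
Proof. by rewrite dotD dotN. Qed.

Lemma dotZ c t x : dot c (t *: x) = t * dot c x.
Proof. by rewrite /dot -scalemxAr mxE. Qed.

Lemma dot0 c : dot c 0 = 0.
Proof. by rewrite /dot mulmx0 mxE. Qed.

Lemma dot0l x : dot 0 x = 0.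
Proof. by rewrite /dot mul0mx mxE. Qed.

Lemma dotNl c x : dot (- c) x = - dot c x.
Proof. by rewrite /dot mulNmx mxE. Qed.

Lemma dotZl c t x : dot (t *: c) x = t * dot c x.
Proof. by rewrite /dot -scalemxAl mxE. Qed.

Lemma dot_suml (J : finType) (a : J -> 'rV[R]_n) x :
  dot (\sum_j a j) x = \sum_j dot (a j) x.
Proof. by rewrite /dot mulmx_suml summxE. Qed.

Lemma dot_eq0 c x : (dot c x == 0) = (c *m x == 0).
Proof.
rewrite /dot; apply/eqP/eqP => [e|->]; last by rewrite mxE.
by apply/matrixP => i j; rewrite !ord1 e mxE.
Qed.

Variables (J : finType) (a : J -> 'rV[R]_n).
Implicit Types (S T : {set J}).

Definition row_span T : 'M[R]_n := (\sum_(j in T) <<a j>>)%MS.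

Definition rk T : nat := \rank (row_span T).

Lemma row_span_mem T j : j \in T -> (a j <= row_span T)%MS.
Proof. by move=> jT; apply: (sumsmx_sup j) => //; rewrite genmxE. Qed.

Lemma row_span_sub m T (B : 'M[R]_(m, n)) :
  (forall j, j \in T -> (a j <= B)%MS) -> (row_span T <= B)%MS.
Proof. by move=> h; apply/sumsmx_subP => j jT; rewrite genmxE; apply: h. Qed.

Lemma row_spanS S T : S \subset T -> (row_span S <= row_span T)%MS.
Proof. by move/fintype.subsetP => ST; apply: row_span_sub => j /ST; apply: row_span_mem. Qed.

Lemma rkS S T : S \subset T -> (rk S <= rk T)%N.
Proof. by move=> ST; apply: mxrankS; apply: row_spanS. Qed.

Lemma rk_le T : (rk T <= n)%N.
Proof. exact: rank_leq_row. Qed.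

Lemma rk_submodular S T : (rk (S :|: T) + rk (S :&: T) <= rk S + rk T)%N.
Proof.
rewrite /rk -(mxrank_sum_cap (row_span S) (row_span T)); apply: leq_add; apply: mxrankS.
  apply: row_span_sub => j; rewrite inE => /orP[jS|jT].
    by apply: submx_trans (addsmxSl _ _); apply: row_span_mem.
  by apply: submx_trans (addsmxSr _ _); apply: row_span_mem.
by rewrite sub_capmx !row_spanS // (finset.subsetIl, finset.subsetIr).
Qed.

Lemma row_span_ker T w : (forall j, j \in T -> dot (a j) w = 0) ->
  (row_span T <= kermx w)%MS.
Proof.
by move=> h; apply: row_span_sub => j jT; apply/sub_kermxP/eqP; rewrite -dot_eq0 h.
Qed.

Lemma rk_full_ker T w : rk T = n -> (forall j, j \in T -> dot (a j) w = 0) -> w = 0.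
Proof.
move=> rT /row_span_ker sub.
have : (1%:M <= kermx w)%MS.
  by apply: submx_trans sub; rewrite sub1mx /row_full; apply/eqP.
by move/sub_kermxP; rewrite mul1mx.
Qed.

Lemma rk_lt_ker T : (rk T < n)%N ->
  exists2 w, w != 0 & forall j, j \in T -> dot (a j) w = 0.
Proof.
move=> rT.
have : cokermx (row_span T) != 0 by rewrite -mxrank_eq0 mxrank_coker subn_eq0 -ltnNge.
case/matrix0Pn => i [k nz]; exists (col k (cokermx (row_span T))).
  by apply/eqP => /colP/(_ i); rewrite mxE [RHS]mxE => e; rewrite e eqxx in nz.
move=> j jT; apply/eqP; rewrite dot_eq0 colE mulmxA.
by move: (row_span_mem jT); rewrite submxE => /eqP ->; rewrite mul0mx.
Qed.

Lemma ratio_test (K : finType) (p q : K -> R) k0 :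
  (forall k, 0 <= p k) -> 0 < q k0 ->
  exists2 t, 0 <= t & (forall k, t * q k <= p k) /\
    (exists2 k, 0 < q k & t * q k = p k).
Proof.
move=> p0 q0.
case: (@arg_minP _ _ _ k0 (fun k => 0 < q k) (fun k => p k / q k) q0) => k qk kmin.
exists (p k / q k); first by rewrite divr_ge0 // ltW.
split; last by exists k => //; rewrite divfK // gt_eqF.
move=> j; have [qj|qj] := ltP 0 (q j).
  by rewrite -ler_pdivlMr //; apply: kmin.
by apply: le_trans (p0 j); apply: mulr_ge0_le0 => //; rewrite divr_ge0 // ltW.
Qed.

Definition feasible (b : J -> R) x := forall j, dot (a j) x <= b j.

Definition tight (b : J -> R) x := [set j | dot (a j) x == b j].

(** While the tight rows do not have full rank, move in a direction that they annihilate and along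
    which [c] does not increase, until a new row becomes tight. Such a row is met because [c] is
    bounded below or, if [c] is constant along the direction, because the rows have full rank and
    the sign is free. *)
Lemma exists_vertex_below (b : J -> R) c (lb : R) x :
  rk [set: J] = n -> (forall x, feasible b x -> lb <= dot c x) -> feasible b x ->
  exists x', [/\ feasible b x', dot c x' <= dot c x & rk (tight b x') = n].
Proof.
move=> rJ clb; have [k] := ubnP #|~: tight b x|; elim: k x => // k IH x /ltnSE leT fx.
have [rT|rT] := eqVneq (rk (tight b x)) n; first by exists x.
have {rT} rT : (rk (tight b x) < n)%N by rewrite ltn_neqAle rT rk_le.
have [w w0 wker] := rk_lt_ker rT.
have ray v : dot c v < 0 -> exists j, 0 < dot (a j) v.
  move=> cv; apply/existsP; apply: contraT; rewrite negb_exists => /forallP nv.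
  have fv t : 0 <= t -> feasible b (x + t *: v).
    move=> t0 j; rewrite dotD dotZ; have := fx j; have := nv j; rewrite -leNgt => vj.
    by have := mulr_ge0_le0 t0 vj; lra.
  pose t := (dot c x - lb + 1) / - dot c v.
  have cx := clb _ fx.
  have t0 : 0 <= t by rewrite divr_ge0 //; lra.
  have := clb _ (fv t t0); rewrite dotD dotZ.
  have -> : t * dot c v = - (dot c x - lb + 1).
    by rewrite /t invrN mulrN mulNr divfK // lt_eqF.
  lra.
have [v [cv vker [j0 vj0]]] : exists v, [/\ dot c v <= 0,
    forall j, j \in tight b x -> dot (a j) v = 0 & exists j, 0 < dot (a j) v].
  have [cw|cw|cw] := ltrgt0P (dot c w).
  - exists (- w); split; first by rewrite dotN; lra.
      by move=> j jT; rewrite dotN wker // oppr0.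
    by apply: ray; rewrite dotN; lra.
  - by exists w; split=> //; [lra | apply: ray].
  have [j wj] : exists j, dot (a j) w != 0.
    apply/existsP; apply: contraT; rewrite negb_exists => /forallP nw.
    case/eqP: w0; apply: (rk_full_ker rJ) => j _; apply/eqP.
    by have := nw j; rewrite negbK.
  case: (ltrgt0P (dot (a j) w)) wj => // wj _.
    by exists w; split=> //; [lra | exists j].
  exists (- w); split; first by rewrite dotN; lra.
    by move=> i iT; rewrite dotN wker // oppr0.
  by exists j; rewrite dotN; lra.
have [t t0 [tle [j1 qj1 tj1]]] :=
  @ratio_test J (fun j => b j - dot (a j) x) (fun j => dot (a j) v) j0
    (fun j => etrans (subr_ge0 _ _) (fx j)) vj0.
have fx' : feasible b (x + t *: v) by move=> j; rewrite dotD dotZ; have := tle j; lra.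
have sub : tight b x \proper tight b (x + t *: v).
  apply/properP; split.
    apply/fintype.subsetP => j jT; rewrite inE dotD dotZ vker // mulr0 addr0.
    by move: jT; rewrite inE.
  exists j1; first by rewrite inE dotD dotZ tj1; apply/eqP; lra.
  by apply/negP => /vker qj0; move: qj1; rewrite qj0 ltxx.
have [|x' [fx'' cx' rx']] := IH (x + t *: v) _ fx'.
  by apply: leq_trans leT; apply: proper_card; rewrite properC.
exists x'; split=> //; apply: le_trans cx' _; rewrite dotD dotZ.
by have := mulr_ge0_le0 t0 cv; lra.
Qed.
End RowSpans.

(** * Splitting a point of a pointed cone into points of smaller faces *)

Section ConeDecomposition.
Variables (R : realType) (n : nat) (J : finType) (d : J -> 'rV[R]_n).
Hypothesis rk_d : rk d [set: J] = n.
Implicit Types (x y u w : 'cV[R]_n).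

Definition zeros x := [set j | dot (d j) x == 0].

(** For [x] in the cone, this is the codimension of the smallest face containing [x]. *)
Definition codim x := rk d (zeros x).

(** This functional is positive on the nonzero points of the cone; it orders the walk from [0] to
    [y]. *)
Let l : 'rV[R]_n := \sum_j d j.

Lemma zerosP x j : reflect (dot (d j) x = 0) (j \in zeros x).
Proof. by rewrite inE; apply: eqP. Qed.

Lemma codim0 : codim 0 = n.
Proof.
rewrite /codim (_ : zeros 0 = finset.setT) //.
by apply/setP => j; rewrite !inE dot0 eqxx.
Qed.

(* The direction of an edge of the spindle [{u | 0 <= d u <= d y}] leaving the
   vertex [u], along which the sum [l] of all rows increases. *)
Lemma spindle_edge y u :
  (forall j, 0 <= dot (d j) u <= dot (d j) y) ->
  rk d (zeros u :|: zeros (y - u)) = n -> u != y ->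
  exists w, [/\ dot l w = 1,
    forall j, j \in zeros u -> 0 <= dot (d j) w,
    forall j, j \in zeros (y - u) -> dot (d j) w <= 0 &
    (n <= (rk d [set j in zeros u :|: zeros (y - u)%R | dot (d j) w == 0%R]).+1)%N].
Proof.
move=> uy rU nuy.
have yu j : 0 <= dot (d j) (y - u) by rewrite dotB; have := uy j; lra.
have L0 : 0 < dot l (y - u).
  rewrite dot_suml lt_neqAle sumr_ge0 ?andbT; last by move=> j _; apply: yu.
  apply/eqP => /esym/eqP; rewrite psumr_eq0; last by move=> j _; apply: yu.
  move/allP => z; case/eqP: nuy; apply/esym/eqP; rewrite -subr_eq0; apply/eqP.
  by apply: (rk_full_ker rk_d) => j _; apply/eqP; apply: z; rewrite mem_index_enum.
pose K : finType := (J + J + bool)%type.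
(* The system describes the feasible directions [w] at [u] with [l w = 1], written as two
   inequalities; rows that are not tight become 0. A vertex of it is an edge direction, and [w0],
   pointing to [y], shows that it is feasible. *)
pose c (k : K) : 'rV[R]_n := match k with
  | inl (inl j) => if j \in zeros u then - d j else 0
  | inl (inr j) => if j \in zeros (y - u) then d j else 0
  | inr true => l | inr false => - l end.
pose b (k : K) : R := match k with inl _ => 0 | inr true => 1 | inr false => -1 end.
have rK : rk c [set: K] = n.
  apply/eqP; rewrite eqn_leq rk_le -{1}rU; apply: mxrankS.
  apply: row_span_sub => j; rewrite inE => /orP[ju|ju].
    have := row_span_mem c (finset.in_setT (inl (inl j) : K)).
    by rewrite /c ju -scaleN1r eqmx_scale // oppr_eq0 oner_eq0.
  by have := row_span_mem c (finset.in_setT (inl (inr j) : K)); rewrite /c ju.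
pose w0 := (dot l (y - u))^-1 *: (y - u).
have Li : 0 < (dot l (y - u))^-1 by rewrite invr_gt0.
have f0 : feasible c b w0.
  move=> [[j|j]|[|]] /=; rewrite /w0 dotZ.
  - case: ifP => [/zerosP ju|_]; last by rewrite dot0l mulr0.
    by rewrite dotNl mulrN oppr_le0 mulr_ge0 ?yu // ltW.
  - case: ifP => [/zerosP ju|_]; last by rewrite dot0l mulr0.
    by rewrite ju mulr0.
  - by rewrite mulVf // gt_eqF.
  - by rewrite dotNl mulrN mulVf // gt_eqF.
have [w [fw _ rw]] := @exists_vertex_below R n K c b 0 0 w0 rK
   (fun x _ => eq_ind_r (fun z => 0 <= z) (lexx 0) (dot0l x)) f0.
have lw : dot l w = 1.
  by have := fw (inr true); have := fw (inr false); rewrite /= dotNl; lra.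
exists w; split=> //.
- by move=> j ju; have := fw (inl (inl j)); rewrite /= ju dotNl; lra.
- by move=> j ju; have := fw (inl (inr j)); rewrite /= ju.
set Z := [set j in _ | _].
have : (row_span c (tight c b w) <= row_span d Z + l)%MS.
  apply: row_span_sub => -[[j|j]|[|]]; rewrite inE /=.
  - case: ifP => [ju|_ _]; last exact: sub0mx.
    rewrite dotNl oppr_eq0 => dw; rewrite -scaleN1r.
    apply: scalemx_sub; apply: submx_trans (addsmxSl _ _); apply: row_span_mem.
    by rewrite !inE dw; move: ju; rewrite inE => ->.
  - case: ifP => [ju|_ _]; last exact: sub0mx.
    move=> dw.
    apply: submx_trans (addsmxSl _ _); apply: row_span_mem.
    by rewrite !inE dw; move: ju; rewrite inE => ->; rewrite orbT.
  - by move=> _; apply: addsmxSr.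
  - by move=> _; rewrite -scaleN1r; apply: scalemx_sub; apply: addsmxSr.
move/mxrankS; rewrite -/(rk c _) rw => /leq_trans; apply.
apply: leq_trans (mxrank_adds_leqif _ _) _.
by rewrite -[X in (_ <= X)%N]addn1 leq_add2l rank_leq_row.
Qed.

(* Walk along edges of the spindle from [0] to [y]: one step changes the
   dimensions of the faces containing [u] and [y - u] by at most one. *)
Lemma cone_decomposition y k :
  (forall j, 0 <= dot (d j) y) -> (codim y + k <= n)%N ->
  exists u, [/\ forall j, 0 <= dot (d j) u <= dot (d j) y,
    (n <= codim u + k)%N & (codim y + k <= codim (y - u)%R)%N].
Proof.
move=> y0 ky; case: k ky => [|k] ky.
  exists 0; split; last by rewrite subr0 addn0.
    by move=> j; rewrite dot0 lexx y0.
  by rewrite codim0 addn0.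
(* [P] selects the vertices of the spindle from which the face of [y - u] still has too large a
   dimension. The walk leaves the last of them with respect to [l], and the next vertex [u'] is the
   answer. *)
pose P u := [/\ forall j, 0 <= dot (d j) u <= dot (d j) y,
  rk d (zeros u :|: zeros (y - u)) = n & (codim (y - u)%R < codim y + k.+1)%N].
pose key u := (zeros u, zeros (y - u)).
have keyP u u' : P u -> P u' -> key u = key u' -> dot l u = dot l u'.
  move=> [_ ru _] _ [e1 e2]; apply/eqP; rewrite -subr_eq0 -dotB; apply/eqP.
  rewrite (_ : u - u' = 0) ?dot0 //.
  apply: (rk_full_ker ru) => j; rewrite inE => /orP[j1|j1].
    have j2 := j1; rewrite e1 in j2.
    by move/zerosP: j1; move/zerosP: j2; rewrite dotB => -> ->; rewrite subr0.
  have j2 := j1; rewrite e2 in j2.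
  by move/zerosP: j1; move/zerosP: j2; rewrite !dotB; lra.
have P0 : P 0.
  split; first by move=> j; rewrite dot0 lexx y0.
    apply/eqP; rewrite eqn_leq rk_le -{1}codim0; apply: rkS; exact: finset.subsetUl.
  by rewrite subr0 -[X in (X < _)%N]addn0 ltn_add2l.
have [u [uy ru cu] umax] := exists_max_of_finite_key keyP (ex_intro _ _ P0).
have nuy : u != y.
  apply/eqP => e; move: cu; rewrite e subrr codim0.
  by rewrite ltnNge ky.
have [w [lw wu wy rZ]] := spindle_edge uy ru nuy.
set Z := [set j in _ | _] in rZ.
have yu j : 0 <= dot (d j) (y - u) by rewrite dotB; have := uy j; lra.
have [j0 wj0] : exists j, 0 < dot (d j) w.
  apply/existsP; apply: contraT; rewrite negb_exists => /forallP nw.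
  have : dot l w <= 0.
    by rewrite dot_suml; apply: sumr_le0 => j _; rewrite leNgt; apply: nw.
  by rewrite lw; lra.
pose p (k : J + J) := match k with inl j => dot (d j) u | inr j => dot (d j) (y - u) end.
pose q (k : J + J) := match k with inl j => - dot (d j) w | inr j => dot (d j) w end.
have p0 i : 0 <= p i by case: i => j /=; [case/andP: (uy j) | apply: yu].
have [t t0 [tle [i1 qi1 ti1]]] := @ratio_test R (J + J)%type p q (inr j0) p0 wj0.
have tpos : 0 < t.
  rewrite lt_neqAle t0 andbT; apply/eqP => te; move: ti1; rewrite -te mul0r.
  case: i1 qi1 => j /= qj /esym/zerosP; first by move/wu; lra.
  by move/wy; lra.
pose u' := u + t *: w.
have u'y j : 0 <= dot (d j) u' <= dot (d j) y.
  rewrite /u' dotD dotZ; have := tle (inl j); have := tle (inr j) => /=.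
  by rewrite dotB; lra.
have ZU : Z \subset zeros u' :|: zeros (y - u').
  apply/fintype.subsetP => j; rewrite !inE => /andP[juy /eqP dw].
  by rewrite /u' !dotB !dotD !dotZ dw mulr0 addr0 -dotB.
have ru' : rk d (zeros u' :|: zeros (y - u')) = n.
  have [j1 j1U dj1] : exists2 j, j \in zeros u' :|: zeros (y - u') & dot (d j) w != 0.
    case: i1 qi1 ti1 => j /= qj tj; exists j.
    - by rewrite !inE /u' dotD dotZ; apply/orP; left; apply/eqP; lra.
    - by apply/eqP; lra.
    - rewrite !inE /u' dotB dotD dotZ; apply/orP; right; apply/eqP.
      by move: tj; rewrite dotB; lra.
    - by apply/eqP; lra.
  apply/eqP; rewrite eqn_leq rk_le; apply: leq_trans rZ _.
  apply: rank_ltmx; rewrite /ltmx row_spanS //=.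
  apply: contra dj1 => sub; rewrite dot_eq0; apply/eqP/sub_kermxP.
  apply: submx_trans (row_span_mem d j1U) _; apply: submx_trans sub _.
  by apply: row_span_ker => j; rewrite !inE => /andP[_ /eqP].
have cu' : (codim y + k.+1 <= codim (y - u')%R)%N.
  rewrite leqNgt; apply/negP => cu'.
  have := umax u' (And3 u'y ru' cu').
  by rewrite /u' dotD dotZ lw; lra.
exists u'; split=> //.
(* At the midpoint of the edge only rows vanishing at both ends vanish, so [codim m <= codim u'] and
   [codim (y - m) <= codim (y - u)]. Submodularity, with rank at least [n - 1] for the union and
   [codim y] for the intersection, bounds [codim u'] from below. *)
pose m := u + (t / 2) *: w.
have mE j : dot (d j) m = (dot (d j) u + dot (d j) u') / 2.
  by rewrite /m /u' !dotD !dotZ; field.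
have mu' : (codim m <= codim u')%N.
  apply: rkS; apply/fintype.subsetP => j /zerosP; rewrite mE => e; apply/zerosP.
  by have := uy j; have := u'y j; lra.
have mu : (codim (y - m)%R <= codim (y - u)%R)%N.
  apply: rkS; apply/fintype.subsetP => j /zerosP; rewrite dotB mE => e; apply/zerosP.
  by rewrite dotB; have := uy j; have := u'y j; lra.
have := rk_submodular d (zeros m) (zeros (y - m)).
have : (codim y <= rk d (zeros m :&: zeros (y - m)%R))%N.
  apply: rkS; apply/fintype.subsetP => j /zerosP e; rewrite !inE dotB mE e.
  by have := uy j; have := u'y j; rewrite e => h1 h2; apply/andP; split; apply/eqP; lra.
have : (rk d Z <= rk d (zeros m :|: zeros (y - m)%R))%N.
  apply: rkS; apply/fintype.subsetP => j; rewrite !inE => /andP[juy /eqP dw].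
  by rewrite /m !dotB !dotD !dotZ dw mulr0 addr0 -dotB.
move: rZ cu mu mu'; rewrite -/(codim m) -/(codim (y - m)%R); clear; lia.
Qed.
End ConeDecomposition.

(** * Integer points near a segment *)

Definition row_of (R : realType) m n (A : 'M[int]_(m, n)) (j : 'I_m) : 'rV[R]_n :=
  row j (int2R R A).

Lemma rk_row_of (R : realType) m n (A : 'M[int]_(m, n)) :
  rk (row_of R A) [set: 'I_m] = \rank (int2R R A).
Proof.
apply/eqP; rewrite eqn_leq; apply/andP; split; apply: mxrankS.
  by apply: row_span_sub => j _; apply: row_sub.
by apply/row_subP => j; apply: row_span_mem; rewrite finset.in_setT.
Qed.

Section IndependentRows.
Variables (R : realType) (n : nat) (J : finType) (a : J -> 'rV[R]_n).

Lemma extend_independent_rows k (T : {set J}) (B : 'M[R]_n) :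
  (k + \rank B <= rk a T)%N ->
  exists2 g : 'I_k -> J, (forall x, g x \in T) &
    \rank (\matrix_x a (g x) + B)%MS = (k + \rank B)%N.
Proof.
elim: k => [|k IH] le.
  have g : 'I_0 -> J by case.
  by exists g => [[]//|]; rewrite add0n [\matrix_x _]flatmx0 adds0mx.
have [g gT rg] := IH (ltnW le).
have [j jT nj] : exists2 j, j \in T & ~~ (a j <= \matrix_x a (g x) + B)%MS.
  apply/exists_inP; apply: contraT; rewrite negb_exists_in => /forall_inP all.
  have /mxrankS : (row_span a T <= \matrix_x a (g x) + B)%MS.
    by apply: row_span_sub => j /all; rewrite negbK.
  by rewrite rg leqNgt -/(rk a T) le.
pose g' (x : 'I_k.+1) := if unlift ord0 x is Some z then g z else j.
exists g'; first by move=> x; rewrite /g'; case: unlift.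
apply/eqP; rewrite eqn_leq; apply/andP; split.
  apply: leq_trans (mxrank_adds_leqif _ _) _.
  by rewrite leq_add2r rank_leq_row.
rewrite addSn -rg; apply: rank_ltmx; rewrite /ltmx; apply/andP; split.
  rewrite addsmx_sub addsmxSr andbT; apply/row_subP => z; rewrite rowK.
  apply: submx_trans (addsmxSl _ _).
  have -> : a (g z) = row (lift ord0 z) (\matrix_x a (g' x)) by rewrite rowK /g' liftK.
  exact: row_sub.
apply: contra nj => sub; apply: submx_trans sub.
apply: submx_trans (addsmxSl _ _).
have -> : a j = row ord0 (\matrix_x a (g' x)) by rewrite rowK /g' unlift_none.
exact: row_sub.
Qed.
End IndependentRows.

(** Selections that repeat a row have determinant zero, so injectivity need not be tracked for
    frames. *)
Lemma Delta_ge m n (A : 'M[int]_(m, n)) (f : {ffun 'I_n -> 'I_m}) :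
  `|\det (rowsub f A)| <= Delta A.
Proof.
have [->|nz] := eqVneq (\det (rowsub f A)) 0.
  rewrite normr0 /Delta; elim/big_ind: _ => // x z x0 z0.
  by rewrite le_max x0.
have inj : injectiveb f.
  apply/injectiveP => x z fxz; apply/eqP; apply: contraNT nz => nxz.
  by apply/eqP; apply: (determinant_alternate nxz) => w; rewrite !mxE fxz.
by rewrite /Delta (bigD1 f) //= le_max lexx.
Qed.

Lemma det_int2R (R : realType) n (E : 'M[int]_n) : \det (int2R R E) = (\det E)%:~R.
Proof. by rewrite -(det_map_mx (intr : {rmorphism int -> R})). Qed.

Lemma rowsub_int2R (R : realType) m n k (f : 'I_k -> 'I_m) (A : 'M[int]_(m, n)) :
  rowsub f (int2R R A) = int2R R (rowsub f A).
Proof. by rewrite /int2R map_mxsub. Qed.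

(* A nonzero integer point of the tube around the segment from [- y] to [y] in
   which all rows of [A] stay within [1] of their values on the segment. *)
Definition near_segment (R : realType) m n (A : 'M[int]_(m, n)) (i : 'I_m)
    (y : 'cV[R]_n) : Prop :=
  exists u : 'cV[int]_n, [/\ u != 0,
    `|dot (row_of R A i) (int2R R u)| <= dot (row_of R A i) y &
    forall k, `|dot (row_of R A k) (int2R R u -
      (dot (row_of R A i) (int2R R u) / dot (row_of R A i) y) *: y)| < 1].

(** * Bases of rows with maximal determinant *)

Section Frames.
Variables (R : realType) (m p e : nat).
Local Notation n := (p + (1 + e))%N.
Variables (A : 'M[int]_(m, n)) (i : 'I_m) (y : 'cV[R]_n).
Local Notation AR := (int2R R A).
Local Notation a := (row_of R A).
Hypothesis rkA : rk a [set: 'I_m] = n.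
Hypothesis rky : (e <= codim a y)%N.
Hypothesis iy : 0 < dot (a i) y.

(* A frame consists of [p] free rows, then row [i], then [e] rows vanishing on [y]. *)
Definition admissible (f : {ffun 'I_n -> 'I_m}) :=
  (f (rshift p (lshift e ord0)) == i) &&
  [forall l : 'I_e, f (rshift p (rshift 1 l)) \in zeros a y].

(** Row [i] does not vanish on [y], hence is independent of the [e] chosen rows that do; [p] further
    rows complete them to a basis. *)
Lemma exists_admissible_frame :
  exists2 f, admissible f & rowsub f AR \in unitmx.
Proof.
have [h hy rh] : exists2 h : 'I_e -> 'I_m, (forall x, h x \in zeros a y) &
    \rank (\matrix_x a (h x)) = e.
  have [|h hy rh] := @extend_independent_rows R n 'I_m a e (zeros a y) 0.
    by rewrite mxrank0 addn0.
  by exists h => //; move: rh; rewrite mxrank0 addn0 addsmx0.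
have hker : (\matrix_x a (h x) <= kermx y)%MS.
  apply/row_subP => x; rewrite rowK; apply/sub_kermxP/eqP; rewrite -dot_eq0.
  by apply/eqP/zerosP.
pose B : 'M[R]_n := (a i + \matrix_x a (h x))%MS.
have rB : \rank B = (1 + e)%N.
  apply/eqP; rewrite eqn_leq; apply/andP; split.
    by apply: leq_trans (mxrank_adds_leqif _ _) _; rewrite rh leq_add2r rank_leq_row.
  suff : (\matrix_x a (h x) < B)%MS by move/rank_ltmx; rewrite rh.
  rewrite /ltmx addsmxSr /=.
  apply/negP => sub; move: iy; rewrite lt_neqAle eq_sym => /andP[/negP iy0 _]; apply: iy0.
  rewrite dot_eq0; apply/eqP/sub_kermxP; apply: submx_trans hker; apply: submx_trans sub.
  exact: addsmxSl.
have [|g _ rg] := @extend_independent_rows R n 'I_m a p [set: 'I_m] B.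
  by rewrite rB rkA.
pose f : {ffun 'I_n -> 'I_m} := [ffun x => (match split x with
  | inl z => g z
  | inr z => match split z with inl _ => i | inr l => h l end end : 'I_m)].
have fi : f (rshift p (lshift e ord0)) = i.
  by rewrite ffunE (unsplitK (inr _ : 'I_p + 'I_(1 + e))) (unsplitK (inl _ : 'I_1 + 'I_e)).
have fh l : f (rshift p (rshift 1 l)) = h l.
  by rewrite ffunE (unsplitK (inr _ : 'I_p + 'I_(1 + e))) (unsplitK (inr _ : 'I_1 + 'I_e)).
have fg z : f (lshift (1 + e) z) = g z.
  by rewrite ffunE (unsplitK (inl _ : 'I_p + 'I_(1 + e))).
exists f; first by rewrite /admissible fi eqxx /=; apply/forallP => l; rewrite fh.
have rowf x : (a (f x) <= rowsub f AR)%MS by rewrite /row_of -row_rowsub row_sub.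
rewrite -row_free_unit -row_leq_rank.
suff /mxrankS : (\matrix_x a (g x) + B <= rowsub f AR)%MS by rewrite rg rB.
rewrite !addsmx_sub; apply/and3P; split.
- by apply/row_subP => z; rewrite rowK -fg.
- by rewrite -[X in a X]fi.
- by apply/row_subP => l; rewrite rowK -fh.
Qed.

Lemma exists_maximal_frame : exists f, [/\ admissible f, rowsub f AR \in unitmx &
  forall g, admissible g -> `|\det (rowsub g AR)| <= `|\det (rowsub f AR)|].
Proof.
have [f0 adm0 unit0] := exists_admissible_frame.
pose v (f : {ffun 'I_n -> 'I_m}) : R := `|\det (rowsub f AR)|.
case: (@arg_maxP _ _ _ f0 admissible v adm0) => f adm fmax.
exists f; split=> //.
rewrite unitmxE unitfE -normr_gt0; apply: lt_le_trans (fmax f0 adm0).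
by rewrite /v normr_gt0 -unitfE -unitmxE.
Qed.

Variable f : {ffun 'I_n -> 'I_m}.
Hypothesis f_adm : admissible f.
Hypothesis f_unit : rowsub f AR \in unitmx.
Hypothesis f_max :
  forall g, admissible g -> `|\det (rowsub g AR)| <= `|\det (rowsub f AR)|.

Definition coord : 'M[R]_(m, n) := AR *m invmx (rowsub f AR).

Lemma coordK : coord *m rowsub f AR = AR.
Proof. by rewrite /coord mulmxKV. Qed.

Lemma coord_frame x z : coord (f x) z = (x == z)%:R.
Proof.
have -> : coord (f x) z = rowsub f coord x z by rewrite !mxE.
by rewrite /coord -mul_rowsub_mx mulmxV // mxE.
Qed.

(** Exchanging the free rows for the rows [g] keeps the frame admissible and multiplies its
    determinant by this minor, so maximality applies. *)
Lemma det_coord_le1 (g : 'I_p -> 'I_m) :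
  `|\det (\matrix_(x < p, z < p) coord (g x) (lshift (1 + e) z))| <= 1.
Proof.
pose g' : {ffun 'I_n -> 'I_m} :=
  [ffun x => (match split x with inl z => g z | inr _ => f x end : 'I_m)].
have g'l x : g' (lshift (1 + e) x) = g x.
  by rewrite ffunE (unsplitK (inl _ : 'I_p + 'I_(1 + e))).
have g'r x : g' (rshift p x) = f (rshift p x).
  by rewrite ffunE (unsplitK (inr _ : 'I_p + 'I_(1 + e))).
have adm : admissible g'.
  case/andP: f_adm => fi fh; rewrite /admissible g'r fi /=.
  by apply/forallP => l; rewrite g'r; apply: (forallP fh).
have := f_max adm.
have -> : rowsub g' AR = rowsub g' coord *m rowsub f AR.
  by rewrite mul_rowsub_mx coordK.
rewrite det_mulmx normrM ger_pMl; last by rewrite normr_gt0 -unitfE -unitmxE.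
have blockE (C : 'M[R]_(m, n)) : rowsub g' C = block_mx
    (\matrix_(x < p, z < p) C (g x) (lshift (1 + e) z))
    (\matrix_(x < p, z < 1 + e) C (g x) (rshift p z))
    (\matrix_(x < 1 + e, z < p) C (f (rshift p x)) (lshift (1 + e) z))
    (\matrix_(x < 1 + e, z < 1 + e) C (f (rshift p x)) (rshift p z)).
  by rewrite -[LHS]submxK; congr block_mx; apply/matrixP => x z; rewrite !mxE ?g'l ?g'r.
rewrite blockE (_ : \matrix_(x < 1 + e, z < p) _ = 0); last first.
  by apply/matrixP => x z; rewrite mxE coord_frame eq_rlshift mxE.
rewrite (_ : \matrix_(x < 1 + e, z < 1 + e) _ = 1%:M); last first.
  by apply/matrixP => x z; rewrite mxE coord_frame eq_rshift mxE.
by rewrite det_ublock det1 mulr1.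
Qed.

Lemma dot_coord k v : dot (a k) v = \sum_x coord k x * dot (a (f x)) v.
Proof.
rewrite /dot /row_of -[in LHS]coordK row_mul -mulmxA mxE.
by apply: eq_bigr => x _; rewrite !mxE; congr (_ * _); apply: eq_bigr => z _; rewrite !mxE.
Qed.

(** The deviation of [u] from its multiple of [y] vanishes on row [i] and on the frame rows that
    annihilate [y]; only the [p] free coordinates contribute. *)
Lemma near_segment_of_frame (D : 'cV[int]_p) (T : int) (u : 'cV[int]_n) :
  rowsub f A *m u = col_mx D (col_mx (const_mx T) 0) -> u != 0 ->
  `|T%:~R| <= dot (a i) y ->
  (forall k, `|\sum_(z < p) coord k (lshift (1 + e) z) *
     ((D z 0)%:~R - T%:~R / dot (a i) y * dot (a (f (lshift (1 + e) z))) y)| < 1) ->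
  near_segment A i y.
Proof.
move=> Eu u0 Ty small.
have fu x : dot (a (f x)) (int2R R u) = (col_mx D (col_mx (const_mx T) 0) x 0)%:~R.
  rewrite -Eu /dot /row_of -row_mul -(map_mxM (intr : {rmorphism int -> R})) !mxE.
  by congr (_ %:~R); apply: eq_bigr => z _; rewrite !mxE.
case/andP: f_adm => /eqP fi /forallP fh.
have iu : dot (a i) (int2R R u) = T%:~R.
  by rewrite -{1}fi fu col_mxEd col_mxEu mxE.
exists u; split=> //; first by rewrite iu.
move=> k; rewrite iu dot_coord big_split_ord /=.
rewrite [X in _ + X]big1 ?addr0 => [|x _].
  apply: le_lt_trans (small k); rewrite le_eqVlt; apply/orP; left; apply/eqP.
  congr `|_|; apply: eq_bigr => z _; rewrite dotB dotZ fu col_mxEu //.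
rewrite dotB dotZ fu col_mxEd -[x]splitK; case: (split x) => l /=.
  have iy0 : dot (a i) y != 0 by rewrite gt_eqF.
  by rewrite col_mxEu [const_mx _ _ _]mxE [l]ord1 fi divfK // subrr mulr0.
have /zerosP -> := fh l.
by rewrite col_mxEd [X in X%:~R]mxE mulr0 subr0 mulr0.
Qed.
End Frames.

(** For each [t] from 0 to [h], round the free coordinate of the point of the line through [y] where
    row [i] equals [t]. These [h + 1] integer vectors outnumber the classes modulo the frame, and
    the difference of two in one class gives [u]. *)
Lemma near_segment_dim2 (R : realType) m e (A : 'M[int]_(m, 1 + (1 + e)))
    (i : 'I_m) (y : 'cV[R]_(1 + (1 + e))) :
  rk (row_of R A) [set: 'I_m] = (1 + (1 + e))%N ->
  (e <= codim (row_of R A) y)%N -> 0 < dot (row_of R A i) y ->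
  (Delta A)%:~R <= dot (row_of R A i) y -> near_segment A i y.
Proof.
move=> rkA rky iy Dy.
have [f [adm funit fmax]] := exists_maximal_frame rkA rky iy.
have unitE : \det (rowsub f A) != 0.
  by move: funit; rewrite unitmxE unitfE rowsub_int2R det_int2R intr_eq0.
set ay := dot _ _ in iy Dy; set h := Num.truncn ay.
have /andP[hle hgt] : h%:R <= ay < h.+1%:R by apply: truncn_itv; apply: ltW.
pose eta := dot (row_of R A (f (lshift (1 + e) 0))) y / ay.
(* The errors [P t - t * eta] lie in a half-open interval of length 1, so any two differ by less
   than 1. *)
pose P (t : 'I_h.+1) : int := Num.ceil (t%:R * eta - 2^-1).
have PP t : (P t)%:~R - 1 < t%:R * eta - 2^-1 <= (P t)%:~R.
  by have := ceil_itv (t%:R * eta - 2^-1 : R); rewrite rmorphB.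
pose w (t : 'I_h.+1) : 'cV[int]_(1 + (1 + e)) :=
  col_mx (const_mx (P t)) (col_mx (const_mx (t%:R)) 0).
have [|t [t' [ntt _ [u Eu]]]] :=
    @lattice_pigeonhole _ (rowsub f A) 'I_h.+1 unit (fun=> tt) w unitE.
  rewrite card_unit mul1n card_ord -(ltr_nat R); apply: le_lt_trans hgt.
  apply: le_trans Dy; rewrite natr_absz ler_int; exact: Delta_ge.
have Eu' : rowsub f A *m u =
    col_mx (const_mx (P t - P t')) (col_mx (const_mx (t%:R - t'%:R)) 0).
  rewrite Eu /w opp_col_mx add_col_mx opp_col_mx add_col_mx.
  by congr (col_mx _ (col_mx _ _)); apply/matrixP => x z; rewrite !mxE ?subr0.
have T0 : (t%:R - t'%:R : int) != 0.
  by rewrite subr_eq0 !natz eqz_nat; apply: contra ntt => /eqP /val_inj ->.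
have u0 : u != 0.
  apply: contraNneq T0 => u0; move: Eu'; rewrite u0 mulmx0.
  move/matrixP/(_ (rshift 1 (lshift e ord0)) 0).
  by rewrite col_mxEd col_mxEu !mxE => <-.
apply: (near_segment_of_frame iy adm funit Eu' u0).
  rewrite -/ay rmorphB /= !natz -!pmulrn; apply: le_trans hle.
  have := ltn_ord t; have := ltn_ord t'; rewrite !ltnS -!(ler_nat R) => h1 h2.
  have := ler0n R t; have := ler0n R t'; rewrite ler_norml; lra.
move=> k; rewrite big_ord_recl big_ord0 addr0 [const_mx _ _ _]mxE -/ay normrM.
have c1 : `|coord R A f k (lshift (1 + e) ord0)| <= 1.
  have := det_coord_le1 adm funit fmax (fun=> k); rewrite det_mx11 mxE; exact.
apply: le_lt_trans (ler_wpM2r (normr_ge0 _) c1) _; rewrite mul1r.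
have -> : (P t - P t')%:~R - (t%:R - t'%:R)%:~R / ay *
   dot (row_of R A (f (lshift (1 + e) ord0))) y =
   ((P t)%:~R - t%:R * eta) - ((P t')%:~R - t'%:R * eta) :> R.
  by rewrite !rmorphB /= !natz -!pmulrn /eta; ring.
by have := PP t; have := PP t'; rewrite ltr_norml; lra.
Qed.

Lemma det_2x2 (R : comNzRingType) (M : 'M[R]_2) :
  \det M = M ord0 ord0 * M ord_max ord_max - M ord0 ord_max * M ord_max ord0.
Proof.
rewrite (expand_det_row M ord0) !big_ord_recl big_ord0 addr0 /cofactor !det_mx11 !mxE /=.
have e1 : lift (ord0 : 'I_2) 0 = ord_max by apply: val_inj.
have e2 : lift (ord_max : 'I_2) 0 = ord0 by apply: val_inj.
rewrite !e1 /= e2 addn0 expr0 addn1 expr1; ring.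
Qed.

Definition residue (M : nat) (Q : int) : 'I_(M.-1.+1) := inord (absz (modz Q M)).

Lemma residue_eq M Q Q' : (0 < M)%N -> residue M Q = residue M Q' ->
  Q - Q' = (divz Q M - divz Q' M) * M%:Z.
Proof.
move=> M0; have Mn0 : M%:Z != 0 by rewrite eqz_nat -lt0n.
have ltm x : (absz (modz x M) < M.-1.+1)%N.
  by rewrite prednK // -ltz_nat gez0_abs ?modz_ge0 // ltz_pmod.
move=> /(congr1 val) /=; rewrite !inordK ?ltm // => /(congr1 Posz).
rewrite !gez0_abs ?modz_ge0 // => e.
by rewrite {1}(divz_eq Q M) {1}(divz_eq Q' M) e; ring.
Qed.

(** A discrete Blichfeldt argument. The coefficients of the rows on the two free frame rows define a
    body [L] of area at least 3. Copies of [L / 2], of area 3/4, are centred at the points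
    [r * (eta0, eta1)] for [r] up to [h]; since [(h + 1) * 3 / 4 > delta], two points of the copies
    are congruent, and by symmetry half the difference of two points of [L] lies in [L]. *)
Lemma near_segment_dim3 (R : realType) m e (A : 'M[int]_(m, 2 + (1 + e)))
    (i : 'I_m) (y : 'cV[R]_(2 + (1 + e))) :
  rk (row_of R A) [set: 'I_m] = (2 + (1 + e))%N ->
  (e <= codim (row_of R A) y)%N -> 0 < dot (row_of R A i) y ->
  4 / 3 * (Delta A)%:~R <= dot (row_of R A i) y -> near_segment A i y.
Proof.
move=> rkA rky iy Dy.
have [f [adm funit fmax]] := exists_maximal_frame rkA rky iy.
have unitE : \det (rowsub f A) != 0.
  by move: funit; rewrite unitmxE unitfE rowsub_int2R det_int2R intr_eq0.
set ay := dot _ _ in iy Dy; set h := Num.truncn ay.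
have /andP[hle hgt] : h%:R <= ay < h.+1%:R by apply: truncn_itv; apply: ltW.
set delta := absz (\det (rowsub f A)).
have dh : (4 * delta + 1 <= 3 * h.+1)%N.
  rewrite addn1 -(ltr_nat R) !natrM -ltr_pdivrMl //; apply: le_lt_trans hgt.
  apply: le_trans Dy; rewrite mulrCA mulrA ler_pM2l; last by lra.
  by rewrite natr_absz ler_int Delta_ge.
pose c0 k := coord R A f k (lshift (1 + e) ord0).
pose c1 k := coord R A f k (lshift (1 + e) ord_max).
pose K : finType := ('I_m * bool)%type.
pose s (k : K) := (-1) ^+ k.2 * c0 k.1.
pose t (k : K) := (-1) ^+ k.2 * c1 k.1.
pose neg (k : K) : K := (k.1, ~~ k.2).
have s_neg k : s (neg k) = - s k by rewrite /s /neg; case: k => k [] /=; ring.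
have t_neg k : t (neg k) = - t k by rewrite /t /neg; case: k => k [] /=; ring.
pose ka : K := (f (lshift (1 + e) ord0), false).
pose kb : K := (f (lshift (1 + e) ord_max), false).
have s_ka : s ka = 1 by rewrite /s /c0 /ka /= coord_frame // eqxx mul1r.
have t_ka : t ka = 0 by rewrite /t /c1 /ka /= coord_frame // mul1r.
have s_kb : s kb = 0 by rewrite /s /c0 /kb /= coord_frame // mul1r.
have t_kb : t kb = 1 by rewrite /t /c1 /kb /= coord_frame // eqxx mul1r.
have det_le1 k j : s k * t j - t k * s j <= 1.
  have := det_coord_le1 adm funit fmax (fun x : 'I_2 => if x == ord0 then k.1 else j.1).
  rewrite det_2x2 ![(\matrix_(_, _) _) _ _]mxE /= -/(c0 k.1) -/(c1 j.1) -/(c1 k.1) -/(c0 j.1) => le1.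
  apply: le_trans (ler_norm _) _; apply: le_trans le1.
  rewrite /s /t.
  have -> : (-1) ^+ k.2 * c0 k.1 * ((-1) ^+ j.2 * c1 j.1) -
    (-1) ^+ k.2 * c1 k.1 * ((-1) ^+ j.2 * c0 j.1) =
    (-1) ^+ k.2 * (-1) ^+ j.2 * (c0 k.1 * c1 j.1 - c1 k.1 * c0 j.1) by ring.
  by rewrite !normrM !normr_sign !mul1r.
(* The grid is so fine that the [h + 1] counting errors [28 * N] together stay below [N ^ 2], the
   surplus left by [dh]. *)
pose N := (28 * h.+1 + 1)%N.
have N0 : (0 < N)%N by rewrite /N addn1.
have NR0 : 0 < N%:R :> R by rewrite ltr0n.
pose eta0 := dot (row_of R A (f (lshift (1 + e) ord0))) y / ay.
pose eta1 := dot (row_of R A (f (lshift (1 + e) ord_max))) y / ay.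
(* [P0 r] and [Q0 r] index the first grid point in the square of side 2 about
   [2 * r * (eta0, eta1)]; [w0 r] and [x0 r] are its distances from the lower left corner. *)
pose P0 (r : nat) : int := Num.ceil (N%:R * (2 * r%:R * eta0 - 1)).
pose Q0 (r : nat) : int := Num.ceil (N%:R * (2 * r%:R * eta1 - 1)).
pose w0 (r : nat) : R := (P0 r)%:~R / N%:R - 2 * r%:R * eta0 + 1.
pose x0 (r : nat) : R := (Q0 r)%:~R / N%:R - 2 * r%:R * eta1 + 1.
have ceilP (z : R) : 0 <= (Num.ceil (N%:R * (z - 1)))%:~R / N%:R - z + 1 < N%:R^-1.
  have := ceil_itv (N%:R * (z - 1)); rewrite rmorphB /= => /andP[lo hi].
  have hi' : z - 1 <= (Num.ceil (N%:R * (z - 1)))%:~R / N%:R by rewrite ler_pdivlMr // [X in X <= _]mulrC.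
  have lo' : ((Num.ceil (N%:R * (z - 1)))%:~R - 1) / N%:R < z - 1 by rewrite ltr_pdivrMr // [X in _ < X]mulrC.
  by move: lo'; rewrite mulrBl mul1r => lo'; apply/andP; split; lra.
have w0P r : 0 <= w0 r < N%:R^-1 by apply: ceilP.
have x0P r : 0 <= x0 r < N%:R^-1 by apply: ceilP.
pose X : finType := ('I_h.+1 * ('I_(N + N) * 'I_(N + N)))%type.
pose good (x : X) := [forall k, s k * (-1 + w0 x.1 + x.2.2%:R / N%:R) +
    t k * (-1 + x0 x.1 + x.2.1%:R / N%:R) < 1].
pose P (x : X) : int := P0 x.1 + x.2.2%:Z.
pose Q (x : X) : int := Q0 x.1 + x.2.1%:Z.
pose T : finType := {x : X | good x}.
have cardT : (4 * N ^ 2 * delta < #|T|)%N.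
  rewrite card_sig -sum1_card -(ltr_nat R) natr_sum.
  have -> : \sum_(x : X | x \in [pred x | good x]) (1%N)%:R =
     \sum_(r < h.+1) \sum_(q < N + N) \sum_(p < N + N) (good (r, (q, p)))%:R :> R.
    rewrite big_mkcond /= (eq_bigr (fun x : X => (good (x.1, (x.2.1, x.2.2)))%:R)); last first.
      by move=> [r [q p]] _ /=; rewrite inE; case: (good _).
    rewrite -(pair_bigA _ (fun r x2 => (good (r, (x2.1, x2.2)))%:R)) /=.
    by apply: eq_bigr => r _; rewrite -(pair_bigA _ (fun q p => (good (r, (q, p)))%:R)).
  apply: (@lt_le_trans _ _ (\sum_(r < h.+1) (3 * N%:R ^+ 2 - 28 * N%:R))); last first.
    apply: ler_sum => r _.
    exact: (planar_count_ge s_neg t_neg s_ka t_ka s_kb t_kb det_le1 N0 (x0P r) (w0P r)).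
  rewrite sumr_const card_ord -mulr_natl.
  have dhR : 4 * delta%:R + 1 <= 3 * h.+1%:R :> R.
    by rewrite -!natrM -[X in _ + X](_ : 1%N%:R = 1) // -natrD ler_nat.
  rewrite natrM natrM natrX.
  have NE : N%:R = 28 * h.+1%:R + 1 :> R by rewrite /N natrD natrM.
  have := ler_wpM2r (sqr_ge0 N%:R) dhR.
  have : 28 * h.+1%:R * N%:R < N%:R ^+ 2 :> R by rewrite expr2 ltr_pM2r // NE; lra.
  by nra.
(* Grid points are in units of [1 / (2 * N)] after halving, so equal residues modulo [2 * N] mean an
   integral difference; there are [4 * N ^ 2] keys. *)
pose key (x : T) := (residue (N + N) (P (val x)), residue (N + N) (Q (val x))).
pose w (x : T) : 'cV[int]_(2 + (1 + e)) :=
  col_mx (\col_z (if z == ord0 then divz (P (val x)) (N + N)%N else divz (Q (val x)) (N + N)%N))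
    (col_mx (const_mx ((val x).1%:Z)) 0).
have [|x [x' [nxx kxx [u Eu]]]] := @lattice_pigeonhole _ (rowsub f A) T _ key w unitE.
  rewrite card_prod !card_ord prednK ?addn_gt0 ?N0 // -/delta.
  by apply: leq_ltn_trans cardT; rewrite addnn -mul2n; apply: eq_leq; ring.
have NN0 : (0 < N + N)%N by rewrite addn_gt0 N0.
have eP := residue_eq NN0 (congr1 fst kxx).
have eQ := residue_eq NN0 (congr1 snd kxx).
case: x x' {kxx} nxx Eu eP eQ => [[r [q p]] gx] [[r' [q' p']] gx'] /= nxx Eu eP eQ.
pose Dp := divz (P (r, (q, p))) (N + N)%N - divz (P (r', (q', p'))) (N + N)%N.
pose Dq := divz (Q (r, (q, p))) (N + N)%N - divz (Q (r', (q', p'))) (N + N)%N.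
rewrite -/Dp in eP; rewrite -/Dq in eQ.
have Eu' : rowsub f A *m u =
    col_mx (\col_z (if z == ord0 then Dp else Dq)) (col_mx (const_mx (r%:Z - r'%:Z)) 0).
  rewrite Eu /w opp_col_mx add_col_mx opp_col_mx add_col_mx /=.
  congr (col_mx _ (col_mx _ _)); apply/matrixP => a b; rewrite !mxE ?subr0 //=.
  by case: ifP.
clearbody Dp Dq.
have u0 : u != 0.
  apply: contraNneq nxx => u0; rewrite u0 mulmx0 in Eu'.
  have er : r%:Z = r'%:Z.
    move/matrixP/(_ (rshift 2 (lshift e ord0)) 0): (Eu').
    by rewrite col_mxEd col_mxEu !mxE => /esym/eqP; rewrite subr_eq0 => /eqP.
  have D0 : Dp = 0.
    move/matrixP/(_ (lshift (1 + e) ord0) 0): (Eu').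
    by rewrite col_mxEu !mxE.
  have D1 : Dq = 0.
    move/matrixP/(_ (lshift (1 + e) ord_max) 0): (Eu').
    by rewrite col_mxEu !mxE.
  have {}er : r = r' by apply: val_inj; case: er.
  apply/eqP/val_inj => /=; move: eP eQ; rewrite D0 D1 !mul0r /P /Q /= er.
  move=> /eqP; rewrite opprD addrACA subrr add0r subr_eq0 => /eqP [/val_inj ->].
  by move=> /eqP; rewrite opprD addrACA subrr add0r subr_eq0 => /eqP [/val_inj ->].
apply: (near_segment_of_frame iy adm funit Eu' u0).
  rewrite -/ay rmorphB /= -!pmulrn; apply: le_trans hle.
  have := ltn_ord r; have := ltn_ord r'; rewrite !ltnS -!(ler_nat R) => h1 h2.
  have := ler0n R r; have := ler0n R r'; rewrite ler_norml; lra.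
move=> k.
pose vv (r p : nat) : R := -1 + w0 r + p%:R / N%:R.
pose uu (r q : nat) : R := -1 + x0 r + q%:R / N%:R.
have -> : \sum_(z < 2) coord R A f k (lshift (1 + e) z) *
   (((\col_z (if z == ord0 then Dp else Dq)) z 0)%:~R - (r%:Z - r'%:Z)%:~R / ay *
     dot (row_of R A (f (lshift (1 + e) z))) y) =
   ((c0 k * vv r p + c1 k * uu r q) - (c0 k * vv r' p' + c1 k * uu r' q')) / 2.
  rewrite !big_ord_recl big_ord0 addr0 ![(\col_z _) _ _]mxE /=.
  have -> : lift ord0 ord0 = ord_max :> 'I_2 by apply: val_inj.
  rewrite -/(c0 k) -/(c1 k) rmorphB /= -?pmulrn.
  have DpE : Dp%:~R = ((P0 r)%:~R + p%:R - (P0 r')%:~R - p'%:R) / (2 * N%:R) :> R.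
    have := congr1 (fun z : int => z%:~R : R) eP.
    rewrite /P /= rmorphM rmorphB !rmorphD /= -?pmulrn natrD => e1.
    by apply: (mulIf (_ : 2 * N%:R != 0)); [rewrite mulf_neq0 ?gt_eqF | rewrite divfK ?mulf_neq0 ?gt_eqF //; lra].
  have DqE : Dq%:~R = ((Q0 r)%:~R + q%:R - (Q0 r')%:~R - q'%:R) / (2 * N%:R) :> R.
    have := congr1 (fun z : int => z%:~R : R) eQ.
    rewrite /Q /= rmorphM rmorphB !rmorphD /= -?pmulrn natrD => e1.
    by apply: (mulIf (_ : 2 * N%:R != 0)); [rewrite mulf_neq0 ?gt_eqF | rewrite divfK ?mulf_neq0 ?gt_eqF //; lra].
  rewrite DpE DqE /vv /uu /w0 /x0 /eta0 /eta1; field.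
  by rewrite !gt_eqF.
have g1 := forallP gx (k, false); have g2 := forallP gx (k, true).
have g3 := forallP gx' (k, false); have g4 := forallP gx' (k, true).
move: g1 g2 g3 g4; rewrite /s /t /= -/(vv r p) -/(uu r q) -/(vv r' p') -/(uu r' q').
by rewrite expr0 expr1 ltr_norml; lra.
Qed.

(** * The gap bound *)

Lemma near_segment_codim2 (R : realType) m n (A : 'M[int]_(m, n)) (i : 'I_m)
    (y : 'cV[R]_n) : (2 <= n)%N ->
  rk (row_of R A) [set: 'I_m] = n -> (n <= codim (row_of R A) y + 2)%N ->
  0 < dot (row_of R A i) y -> (Delta A)%:~R <= dot (row_of R A i) y ->
  near_segment A i y.
Proof.
case: n A y => [|[|e]] A y // _ rkA cy.
by apply: near_segment_dim2 => //; rewrite -(leq_add2r 2) addn2.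
Qed.

Lemma near_segment_codim3 (R : realType) m n (A : 'M[int]_(m, n)) (i : 'I_m)
    (y : 'cV[R]_n) : (3 <= n)%N ->
  rk (row_of R A) [set: 'I_m] = n -> (n <= codim (row_of R A) y + 3)%N ->
  0 < dot (row_of R A i) y -> 4 / 3 * (Delta A)%:~R <= dot (row_of R A i) y ->
  near_segment A i y.
Proof.
case: n A y => [|[|[|e]]] A y // _ rkA cy.
by apply: near_segment_dim3 => //; rewrite -(leq_add2r 3) addn3.
Qed.

Lemma rk_scale (R : realType) n (J : finType) (a : J -> 'rV[R]_n) (c : J -> R) T :
  (forall j, c j != 0) -> rk (fun j => c j *: a j) T = rk a T.
Proof.
move=> c0; apply/eqP; rewrite eqn_leq; apply/andP; split; apply: mxrankS;
  apply: row_span_sub => j jT.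
  by apply: scalemx_sub; apply: row_span_mem.
by have := row_span_mem (fun j => c j *: a j) jT; rewrite eqmx_scale.
Qed.

Lemma Delta_gt0 (R : realType) m n (A : 'M[int]_(m, n)) :
  rk (row_of R A) [set: 'I_m] = n -> 0 < (Delta A)%:~R :> R.
Proof.
rewrite rk_row_of => rA.
have full : row_full (int2R R A) by apply/eqP.
have := fullrowsub_unit full; set f := fullrankfun full => fu.
rewrite ltr0z; apply: lt_le_trans (Delta_ge A f).
by move: fu; rewrite unitmxE unitfE rowsub_int2R det_int2R intr_eq0 normr_gt0.
Qed.

Section Gap.
Variables (R : realType) (m n : nat) (A : 'M[int]_(m, n)) (i : 'I_m).
Variable y : 'cV[R]_n.
Local Notation a := (row_of R A).
Hypothesis n_ge2 : (2 <= n)%N.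
Hypothesis rkA : rk a [set: 'I_m] = n.

Definition sgn j : R := if 0 <= dot (a j) y then 1 else -1.

(** Both [y'] and [y - y'] lie in the cone with the sign pattern of [y]. *)
Definition between (y' : 'cV[R]_n) : Prop :=
  forall j, 0 <= sgn j * dot (a j) y' <= sgn j * dot (a j) y.

Hypothesis no_near : forall y', between y' -> 0 < dot (a i) y' -> ~ near_segment A i y'.

Let d j := sgn j *: a j.

Let sgn_neq0 j : sgn j != 0.
Proof. by rewrite /sgn; case: ifP => _; rewrite ?oppr_eq0 oner_eq0. Qed.

Let codimE x : codim d x = codim a x.
Proof.
rewrite /codim rk_scale // (_ : zeros d x = zeros a x) //.
by apply/setP => j; rewrite !inE dotZl mulf_eq0 (negbTE (sgn_neq0 j)).
Qed.

Let D : R := (Delta A)%:~R.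

Let D_gt0 : 0 < D.
Proof. exact: Delta_gt0 rkA. Qed.

Lemma gap_dim2 y' : between y' -> (n <= codim a y' + 2)%N -> dot (a i) y' < D.
Proof.
move=> yb cy; rewrite ltNge; apply/negP => le.
have y0 : 0 < dot (a i) y' by apply: lt_le_trans le.
exact: no_near yb y0 (near_segment_codim2 n_ge2 rkA cy y0 le).
Qed.

Lemma gap_dim3 y' : between y' -> (n <= codim a y' + 3)%N -> dot (a i) y' < 4 / 3 * D.
Proof.
move=> yb cy; have [n3|n3] := leqP 3 n; last first.
  have : dot (a i) y' < D.
    by apply: gap_dim2 => //; apply: leq_trans (leq_addl _ _); rewrite -ltnS.
  by have := D_gt0; lra.
rewrite ltNge; apply/negP => le.
have y0 : 0 < dot (a i) y'.
  by apply: lt_le_trans le; apply: mulr_gt0 => //; lra.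
exact: no_near yb y0 (near_segment_codim3 n3 rkA cy y0 le).
Qed.

Lemma gap_split y' k r : between y' -> (codim a y' + r = n)%N -> (k <= r)%N ->
  exists u, [/\ between u, between (y' - u), (n <= codim a u + k)%N &
    (n <= codim a (y' - u) + (r - k))%N].
Proof.
move=> yb cy kr.
have [|||u [uy cu cyu]] := @cone_decomposition R n 'I_m d _ y' k.
- by rewrite rk_scale.
- by move=> j; rewrite dotZl; case/andP: (yb j).
- by rewrite codimE; move: cy kr; lia.
rewrite !codimE in cu cyu.
exists u; split=> //.
- move=> j; have := uy j; rewrite !dotZl => /andP[-> /le_trans]; apply.
  by case/andP: (yb j).
- move=> j; have := uy j; rewrite !dotZl dotB mulrBr => /andP[u0 uy'].
  by case/andP: (yb j) => y0 yy; apply/andP; split; lra.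
- by move: cyu cy kr; lia.
Qed.

(** The bound [(4 * r + 2) / 9] grows by [4 / 3] when [r] grows by 3, matching a split-off piece of
    dimension 3. It exceeds 1 and [4 / 3] for [r] equal to 2 and 3, and equals 2 for [r = 4], where
    two pieces of dimension 2 are used. *)
Lemma gap_between y' r : (2 <= r)%N -> between y' -> (n <= codim a y' + r)%N ->
  dot (a i) y' < (4 * r + 2)%:R / 9 * D.
Proof.
have D0 := D_gt0.
have bE q : (4 * q + 2)%:R / 9 * D = (4 * q%:R + 2) / 9 * D by rewrite natrD natrM.
elim/ltn_ind: r y' => r IH y' r2 yb cy; rewrite bE.
have [r3|r3] := leqP r 3.
  move: r2 cy; rewrite leq_eqVlt => /orP[/eqP <-|r3'] cy.
    by have := gap_dim2 yb cy; lra.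
  have er : r = 3 by apply/eqP; rewrite eqn_leq r3.
  by move: cy; rewrite er => cy; have := gap_dim3 yb cy; lra.
(* If the face has dimension below [r], the smaller bound for [r.-1] applies; so the dimension is
   exactly [r] when splitting. *)
have [c1|c1] := leqP n (codim a y' + r.-1).
  have r1 : (r.-1 < r)%N by rewrite prednK // ltnW // ltnW.
  have r12 : (2 <= r.-1)%N by rewrite -ltnS prednK // ltnW // ltnW.
  have := IH _ r1 y' r12 yb c1; rewrite bE.
  have -> : r%:R = r.-1%:R + 1 :> R by rewrite natr1 prednK // ltnW // ltnW.
  by move=> h; apply: lt_trans h _; rewrite ltr_pM2r //; lra.
have {}cy : (codim a y' + r = n)%N.
  by apply/eqP; rewrite eqn_leq cy andbT; lia.
have [r4|r4] := leqP r 4.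
  have er : r = 4 by apply/eqP; rewrite eqn_leq r4.
  have [|u [ub yub cu cyu]] := gap_split (k := 2) yb cy; first by rewrite er.
  rewrite er in cyu.
  have := gap_dim2 ub cu; have := gap_dim2 yub cyu; rewrite er dotB.
  lra.
have [|u [ub yub cu cyu]] := gap_split (k := 3) yb cy; first by lia.
have r3' : (r - 3 < r)%N by lia.
have r32 : (2 <= r - 3)%N by lia.
have := IH _ r3' _ r32 yub cyu; have := gap_dim3 ub cu; rewrite bE dotB natrB; last by lia.
lra.
Qed.

Lemma gap_lt : dot (a i) y < (4 * n + 2)%:R / 9 * D.
Proof.
apply: gap_between => //; last exact: leq_addl.
move=> j; rewrite lexx andbT /sgn; case: ifP => [h|/negbT]; first by rewrite mul1r.
by rewrite -ltNge mulN1r oppr_ge0 => /ltW.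
Qed.
End Gap.

Lemma dot_int2R (R : realType) m n (A : 'M[int]_(m, n)) (z : 'cV[int]_n) k :
  dot (row_of R A k) (int2R R z) = ((A *m z) k 0)%:~R.
Proof.
rewrite /dot /row_of -row_mul -(map_mxM (intr : {rmorphism int -> R})) !mxE.
by congr (_ %:~R); apply: eq_bigr => x _; rewrite !mxE.
Qed.

Lemma dot_row_of (R : realType) m n (A : 'M[int]_(m, n)) (x : 'cV[R]_n) k :
  dot (row_of R A k) x = (int2R R A *m x) k 0.
Proof. by rewrite /dot /row_of -row_mul mxE. Qed.

(** * Integer points near a segment contradict the minimality of [z] *)

Section Minimality.
Variables (R : realType) (m n : nat) (A : 'M[int]_(m, n)) (b : 'cV[int]_m).
Variables (i : 'I_m) (S : {set 'I_m}) (z : 'cV[int]_n) (x : 'cV[R]_n).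
Local Notation a := (row_of R A).
Hypothesis rkA : rk a [set: 'I_m] = n.
Hypothesis z_feas : forall k, k \in S -> (A *m z) k 0 <= b k 0.
Hypothesis z_min : forall z' : 'cV[int]_n, (forall k, k \in S -> (A *m z') k 0 <= b k 0) ->
  (A *m z) i 0 <= (A *m z') i 0.
Hypothesis x_feas : forall k, dot (a k) x <= (b k 0)%:~R.

Let y := int2R R z - x.

Let not_near_pos y' (u : 'cV[int]_n) : between A y y' -> 0 < dot (a i) y' ->
  0 < dot (a i) (int2R R u) <= dot (a i) y' ->
  ~ (forall k, `|dot (a k) (int2R R u -
      (dot (a i) (int2R R u) / dot (a i) y') *: y')| < 1).
Proof.
move=> yb y0 /andP[u0 uy] near.
set tau := _ / _ in near.
have tau0 : 0 <= tau by rewrite divr_ge0 // ltW.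
have tau1 : tau <= 1 by rewrite ler_pdivrMr // mul1r.
suff feas k : k \in S -> (A *m (z - u)) k 0 <= b k 0.
  have := z_min feas; rewrite mulmxBr !mxE lerBrDr gerDl => le0.
  move: u0; rewrite dot_int2R ltr0z ltNge; case/negP.
  by move: le0; rewrite mxE.
(* By integrality [a_k (z - u) < b_k + 1] suffices. If [a_k y >= 0], then [a_k u > -1] and [z] is
   compared; otherwise [a_k u > a_k y - 1], and [a_k (z - u) < a_k x + 1]. *)
move=> kS; rewrite -ltzD1 -(ltr_int R) rmorphD /= -dot_int2R.
have zk : dot (a k) (int2R R z) <= (b k 0)%:~R by rewrite dot_int2R ler_int z_feas.
have -> : int2R R (z - u) = int2R R z - int2R R u.
  by apply/matrixP => p q; rewrite !mxE rmorphB.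
have := near k; have := yb k; have := x_feas k.
rewrite /sgn !dotB !dotZ ltr_norml => xk; case: ifP => [yk|/negbT].
  rewrite !mul1r => /andP[y'0 _] /andP[lo hi].
  by have := mulr_ge0 tau0 y'0; lra.
rewrite -ltNge !mulN1r !oppr_ge0 lerN2 => yk /andP[y'0 y'y] /andP[lo hi].
have : tau * - dot (a k) y' <= - dot (a k) y'.
  by apply: ler_piMl => //; rewrite oppr_ge0.
lra.
Qed.

Lemma not_near_segment y' : between A y y' -> 0 < dot (a i) y' ->
  ~ near_segment A i y'.
Proof.
move=> yb y0 [u [u0 uy near]].
have [ai0|ai0|ai0] := ltrgt0P (dot (a i) (int2R R u)).
- apply: (not_near_pos yb y0 _ near); rewrite ai0 /=.
  by move: uy; rewrite gtr0_norm.
- have NE : int2R R (- u) = - int2R R u by apply/matrixP => p q; rewrite !mxE rmorphN.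
  apply: (@not_near_pos y' (- u) yb y0); rewrite NE dotN.
    by rewrite oppr_gt0 ai0 /=; move: uy; rewrite ltr0_norm.
  by move=> k; rewrite mulNr scaleNr -opprD dotN normrN; apply: near.
case/eqP: u0.
(* Here each [a_k u] is an integer of absolute value below 1, so full rank forces [u = 0]. *)
have /matrixP uR0 : int2R R u = 0.
  apply: (rk_full_ker rkA) => k _; have := near k.
  rewrite ai0 mul0r scale0r subr0 dot_int2R -intr_norm -[1]/(1%:~R) ltr_int.
  by move=> lt1; apply/eqP; rewrite intr_eq0 -normr_eq0; lia.
apply/matrixP => p q; apply/eqP; rewrite [X in _ == X]mxE -(intr_eq0 R).
by have := uR0 p q; rewrite !mxE => ->.
Qed.
End Minimality.

(** * Minimal subsystems without integer points and the width bound *)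

Lemma exists_min_integer_point m n (A : 'M[int]_(m, n)) (i : 'I_m) (lb : int)
    (P : 'cV[int]_n -> Prop) z0 :
  P z0 -> (forall z, P z -> lb <= (A *m z) i 0) ->
  exists2 z, P z & forall z', P z' -> (A *m z) i 0 <= (A *m z') i 0.
Proof.
move=> P0 Plb.
pose Q (k : nat) := `[< exists2 z, P z & (A *m z) i 0 = lb + k%:Z >].
have exQ : exists k, Q k.
  exists (absz ((A *m z0) i 0 - lb)%R); apply/asboolP; exists z0 => //.
  by rewrite gez0_abs ?subr_ge0 ?Plb // addrC subrK.
case: (ex_minnP exQ) => k /asboolP[z Pz zk] kmin.
exists z => // z' Pz'.
have : Q (absz ((A *m z') i 0 - lb)%R).
  by apply/asboolP; exists z' => //; rewrite gez0_abs ?subr_ge0 ?Plb // addrC subrK.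
move/kmin; rewrite -lez_nat gez0_abs ?subr_ge0 ?Plb // zk; lia.
Qed.

Theorem theorem4 (R : realType) (m n : nat) (A : 'M[int]_(m, n))
  (b : 'cV[int]_m) :
  (2 <= n)%N ->
  \rank (@int2R R _ _ A) = n ->
  full_dimensional (@polyhedron R _ _ A b) ->
  lattice_free (@polyhedron R _ _ A b) ->
  (forall i : 'I_m, @row_defines_facet R _ _ A b i) ->
  exists i : 'I_m,
    (width (row i (@int2R R _ _ A)) (@polyhedron R _ _ A b) <
     (((4 * n + 2)%:R / 9) * (Delta A)%:~R - 1)%:E)%E.
Proof.
move=> n2 rA [x1 [e e0 x1P]] lfree _.
have rkA : rk (row_of R A) [set: 'I_m] = n by rewrite rk_row_of.
pose empty (S : {set 'I_m}) :=
  `[< forall z : 'cV[int]_n, ~ (forall k, k \in S -> (A *m z) k 0 <= b k 0) >].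
have emptyT : empty [set: 'I_m].
  apply/asboolP => z zP; apply: (lfree z) => k.
  by rewrite -dot_row_of dot_int2R ler_int zP // finset.in_setT.
have [S /minsetP [/asboolP emptyS minS] _] := minset_exists emptyT.
have [i iS] : exists i, i \in S.
  apply/set0Pn; apply/eqP => S0; apply: (emptyS 0) => k.
  by rewrite S0 finset.in_set0.
have [z0 z0P] : exists z : 'cV[int]_n, forall k, k \in S :\ i -> (A *m z) k 0 <= b k 0.
  apply: contrapT => nz.
  have E : empty (S :\ i) by apply/asboolP => z zP; apply: nz; exists z.
  by have := minS _ E (finset.subD1set _ _) => /setP/(_ i); rewrite !inE eqxx iS.
have Plb (z : 'cV[int]_n) : (forall k, k \in S :\ i -> (A *m z) k 0 <= b k 0) ->
    b i 0 + 1 <= (A *m z) i 0.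
  move=> zP; rewrite lezD1 ltNge; apply/negP => le; apply: (emptyS z) => k kS.
  by have [->//|nki] := eqVneq k i; apply: zP; rewrite !inE nki.
have [z zP zmin] := @exists_min_integer_point m n A i _ _ z0 z0P Plb.
exists i.
set B := _ - 1.
(* The term -1 of the bound comes from [a_i z >= b_i + 1]. *)
have gap x : polyhedron A b x -> (b i 0)%:~R - dot (row_of R A i) x < B.
  move=> xP.
  have xf k : dot (row_of R A k) x <= (b k 0)%:~R by rewrite dot_row_of.
  have := gap_lt n2 rkA (fun y' => @not_near_segment R m n A b i (S :\ i) z x rkA zP zmin xf y').
  rewrite dotB dot_int2R /B.
  have : (b i 0 + 1)%:~R <= ((A *m z) i 0)%:~R :> R by rewrite ler_int Plb.
  rewrite rmorphD /=; lra.
have feasP x : polyhedron A b x <-> feasible (row_of R A) (fun k => (b k 0)%:~R) x.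
  by split=> h k; have := h k; rewrite dot_row_of.
have P1 : polyhedron A b x1 by apply: x1P => j; rewrite subrr normr0.
pose beta (k : 'I_m) : R := (b k 0)%:~R.
pose V x := polyhedron A b x /\ rk (row_of R A) (tight (row_of R A) beta x) = n.
have below x : polyhedron A b x -> exists2 x', V x' & dot (row_of R A i) x' <= dot (row_of R A i) x.
  move=> /feasP fx.
  have lb x' : feasible (row_of R A) beta x' -> (b i 0)%:~R - B <= dot (row_of R A i) x'.
    by move=> /feasP /gap; lra.
  have [x' [fx' le rx']] := exists_vertex_below rkA lb fx.
  by exists x' => //; split=> //; apply/feasP.
(* The infimum is attained at the vertex [x2], so the strict inequality [gap] passes to the
   width. *)
have [x2 [x2P _] x2min] : exists2 x2, V x2 & forall x', V x' ->
    - dot (row_of R A i) x' <= - dot (row_of R A i) x2.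
  apply: (@exists_max_of_finite_key R _ _ (tight (row_of R A) beta)); last first.
    by have [x' Vx' _] := below _ P1; exists x'.
  move=> x x' [_ rx] _ ex; congr (- _); apply/eqP; rewrite -subr_eq0 -dotB.
  rewrite (_ : x - x' = 0) ?dot0 //; apply: (rk_full_ker rx) => k kx.
  have kx' := kx; rewrite ex in kx'.
  by move: kx kx'; rewrite !inE dotB => /eqP -> /eqP ->; rewrite subrr.
have inf_ge x : polyhedron A b x -> dot (row_of R A i) x2 <= dot (row_of R A i) x.
  by move=> /below [x' /x2min]; rewrite lerN2 => h1 h2; apply: le_trans h1 h2.
rewrite /width.
apply: (@le_lt_trans _ _ ((b i 0)%:~R%:E - (dot (row_of R A i) x2)%:E)%E); last first.
  by rewrite -EFinB lte_fin gap.
apply: leeB.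
  apply: ge_ereal_sup => _ [x xP <-]; rewrite lee_fin.
  by have := xP i; rewrite -dot_row_of.
by apply: le_ereal_inf_tmp => _ [x xP <-]; rewrite lee_fin; apply: inf_ge.
Qed.
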